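(* If $G$ is an infinitely generated, countably based abelian profinite group, then $G$ can be decomposed as a product of infinitely many non-trivial groups; that is, $G$ is topologically isomorphic to an unrestricted Cartesian product $\prod_{i\in I}K_i$ (with the product topology) with $I$ infinite and each $K_i$ a non-trivial profinite group.
   Context: A profinite group is countably based if its identity has a countable neighbourhood basis. ''Infinitely generated'' means not topologically finitely generated, i.e. no finite subset generates a dense subgroup. *)

(* Defs.v *)
From HB Require Import structures.
From mathcomp Require Import all_boot all_algebra.
From mathcomp Require Import all_classical topology tvs.

Set Implicit Arguments.
Unset Strict Implicit.
Unset Printing Implicit Defensive.

Import GRing.Theory.
Local Open Scope classical_set_scope.
Local Open Scope ring_scope.

(* Abelian topological groups are the library's [topologicalZmodType], written
   additively; the topology is not assumed Hausdorff. *)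

Definition profinite (G : topologicalZmodType) :=
  [/\ compact [set: G], hausdorff_space G & totally_disconnected [set: G]].

Definition countably_based (G : topologicalZmodType) :=
  exists B : set (set G),
    [/\ countable B, B `<=` nbhs (0 : G)
      & forall U, nbhs (0 : G) U -> exists2 V, B V & V `<=` U].

Definition generated_subgroup (G : zmodType) (A : set G) : set G :=
  smallest (fun H : set G => zmod_closed (mem H)) A.

Definition topologically_finitely_generated (G : topologicalZmodType) :=
  exists2 A : set G, finite_set A & dense (generated_subgroup A).

Definition topologically_isomorphic (G H : topologicalZmodType) :=
  exists (f : {additive G -> H}) (g : H -> G),
    [/\ cancel f g, cancel g f, continuous f & continuous g].

Section ProductGroup.
Variables (I : Type) (K : I -> topologicalZmodType).
Local Notation P := (prod_topology K).

Let prod_zero : P := fun=> 0.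
Let prod_opp (x : P) : P := fun i => - x i.
Let prod_add (x y : P) : P := fun i => x i + y i.

Let prod_addA : associative prod_add.
Proof. by move=> x y z; apply: functional_extensionality_dep => i; exact: addrA. Qed.
Let prod_addC : commutative prod_add.
Proof. by move=> x y; apply: functional_extensionality_dep => i; exact: addrC. Qed.
Let prod_add0 : left_id prod_zero prod_add.
Proof. by move=> x; apply: functional_extensionality_dep => i; exact: add0r. Qed.
Let prod_addN : left_inverse prod_zero prod_opp prod_add.
Proof. by move=> x; apply: functional_extensionality_dep => i; exact: addNr. Qed.

HB.instance Definition _ :=
  GRing.isZmodule.Build P prod_addA prod_addC prod_add0 prod_addN.

Let prod_sub_continuous : continuous (fun x : P * P => x.1 - x.2).
Proof.
have pc (i : I) : continuous (fun x : P => x i).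
  exact: (@proj_continuous {classic I} K i).
pose d (x : P * P) : P := x.1 - x.2.
move=> x; apply/cvg_sup => i.
suff: continuous (d : P * P -> initial_topology (fun f : P => f i)) by apply.
apply: continuous_comp_initial => z.
apply: (@continuous_comp _ _ _ (fun y : P * P => (y.1 i, y.2 i))
  (fun u : K i * K i => u.1 - u.2)); last exact: sub_continuous.
apply: cvg_pair => /=.
  by apply: (@continuous_comp _ _ _ fst (fun y : P => y i)); [exact: cvg_fst|exact: pc].
by apply: (@continuous_comp _ _ _ snd (fun y : P => y i)); [exact: cvg_snd|exact: pc].
Qed.

HB.instance Definition _ :=
  PreTopologicalNmodule_isTopologicalZmodule.Build P prod_sub_continuous.

End ProductGroup.

(* Main.v *)
From HB Require Import structures.
Require Import Defs.
From mathcomp Require Import all_boot all_algebra.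
From mathcomp Require Import all_classical topology tvs.
From mathcomp Require cyclic.

(* Write D_p for the p-divisible part of G and E_p for its pro-p part; then G is
   the direct sum of D_p and E_p, and G is topologically finitely generated as
   soon as all quotients G/pG are finite and only finitely many E_p are non-zero.
   So either infinitely many E_p are non-zero or some G/pG is infinite.  In both
   cases every open subgroup U contains a non-zero closed direct factor C of G
   with a complement of the same kind:
   - in the first case C is E_p for a prime p not dividing |G/U|;
   - in the second case C is procyclic.  If some x in U has order p^(n+1) and
     p^n x is not in p^(n+1) G, a subgroup maximal among those containing
     p^(n+1) G and avoiding p^n x is a complement of <x>.  If there is no such x,
     then the p-torsion of G has bounded exponent and is finite modulo pG, and a
     closed complement of the closure of <x>, for a suitable x in U, is obtained
     as the intersection of open subgroups V_n with G/V_n cyclic of order p^n,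
     generated by x.
   Iterating along a countable basis (W_n) of open subgroups gives orthogonal
   continuous idempotents e_n with image in W_n.  The intersection H of the
   successive complements is itself a direct factor, and adding the projection
   onto H to e_0 makes the e_n jointly injective; by compactness the map from G
   to the product of their images is then an isomorphism. *)

Set Implicit Arguments.
Unset Strict Implicit.
Unset Printing Implicit Defensive.

Import GRing.Theory.
Local Open Scope classical_set_scope.
Local Open Scope ring_scope.

(** * Clopen neighbourhoods in compact spaces *)

Section CompactSpaces.
Variable T : topologicalType.
Hypothesis cptT : compact [set: T].

(** Any cluster point of [u] works. This replaces convergent subsequences: each property wanted of a
    limit is phrased as a closed condition that holds on a tail. *)
Lemma cluster_seq (u : nat -> T) : exists l, forall A : set T,
  closed A -> (exists N, forall n, (N <= n)%N -> A (u n)) -> A l.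
Proof.
have [l [_ cl]] := cptT (F := u @ \oo) _ filterT.
exists l => A cA [N AN]; apply: cA => B lB; apply: cl => //.
by exists N => // n /= Nn; exact: AN.
Qed.

Definition quasi_component (x : T) :=
  [set y | forall K : set T, clopen K -> K x -> K y].

(** If no clopen [K] containing [x] fits in [O], the sets [K] minus [O] generate a proper filter. A
    cluster point of it lies in every such [K], hence in [O], which the filter avoids. *)
Lemma quasi_component_clopen x (O : set T) : open O ->
  quasi_component x `<=` O -> exists K, [/\ clopen K, K x & K `<=` O].
Proof.
move=> oO qO; apply: contrapT => nK.
pose D := [set K : set T | clopen K /\ K x].
pose F := filter_from D (fun K => K `\` O).
have FF : ProperFilter F.
  apply: filter_from_proper; last first.
    move=> K [cK Kx]; apply: contrapT => KO; apply: nK; exists K; split => //.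
    by move=> y Ky; apply: contrapT => nOy; apply: KO; exists y.
  apply: filter_from_filter; first by exists setT; split => //; exact: clopenT.
  move=> A B [cA Ax] [cB Bx]; exists (A `&` B).
    by split => //; exact: clopenI.
  by move=> y [[? ?] ?].
have [l [_ cl]] := cptT FF filterT.
have /qO Ol : quasi_component x l.
  move=> K cK Kx; case: (cK) => _; apply => B lB.
  have FKO : F (K `\` O) by exists K.
  by have [y [[Ky _] By]] := cl _ _ FKO lB; exists y.
have FO : F (setT `\` O) by exists setT => //; split => //; exact: clopenT.
by have [y [[_ nOy]]] := cl _ _ FO (open_nbhs_nbhs (conj oO Ol)).
Qed.

(** Normality separates the closed pieces [B] and [Q] minus [C] by disjoint open sets. A clopen [K]
    around [x] inside their union is cut into two clopen parts, and the part containing [x] must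
    contain all of [Q]. *)
Lemma connected_quasi_component x : hausdorff_space T ->
  connected (quasi_component x).
Proof.
move=> hT B [b Bb] [C oC BC] [D cD BD].
set Q := quasi_component x in BC BD *.
have cQ : closed Q.
  rewrite (_ : Q = \bigcap_(K in [set K | clopen K /\ K x]) K); last first.
    by apply/seteqP; split => [y Qy K [cK Kx]|y Qy K cK Kx]; exact: Qy.
  by apply: closed_bigI => K [[]].
have cB : closed B by rewrite BD; exact: closedI.
have cE : closed (Q `\` C) by apply: closedI => //; exact: open_closedC.
have [U nU UE] : filter_from (set_nbhs B) closure (~` (Q `\` C)).
  apply: compact_normal => // y By; apply: open_nbhs_nbhs; split.
    exact: closed_openC.
  by move: By; rewrite BC => -[Qy Cy] [].
have /set_nbhsP[U' [oU' BU' U'U]] := nU.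
have QUV : Q `<=` U' `|` ~` closure U.
  move=> y Qy; have [Cy|nCy] := pselect (C y).
    by left; apply: BU'; rewrite BC.
  by right => /UE; apply.
have oUV : open (U' `|` ~` closure U).
  by apply: openU => //; exact/closed_openC/closed_closure.
have [K [[oK cK] Kx KUV]] := quasi_component_clopen oUV QUV.
have KU'E : K `&` U' = K `&` closure U.
  apply/seteqP; split => y [Ky].
    by move=> U'y; split => //; apply/subset_closure/U'U.
  by have [? //|] := KUV _ Ky.
have cKU : clopen (K `&` U').
  split; first exact: openI.
  by rewrite KU'E; apply: closedI => //; exact: closed_closure.
have [U'x|nU'x] := pselect (U' x).
  rewrite BC; apply/seteqP; split => [y []//|y Qy]; split => //.
  apply: contrapT => nCy; have [_ U'y] := Qy _ cKU (conj Kx U'x).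
  have : closure U y by apply/subset_closure/U'U.
  by move/UE; apply.
have Qb : Q b by move: Bb; rewrite BC => -[].
have cKV : clopen (K `&` ~` U').
  split; last by apply: closedI => //; exact: open_closedC.
  rewrite (_ : _ `&` _ = K `&` ~` (K `&` U')).
    by apply: openI => //; apply: closed_openC; case: cKU.
  apply/seteqP; split => y [Ky nU'y]; split => // U'y; apply: nU'y => //.
  by case: U'y.
by have [_] := Qb _ cKV (conj Kx nU'x); case; exact: BU'.
Qed.

Lemma compact_clopen_nbhs (x : T) (U : set T) : hausdorff_space T ->
  totally_disconnected [set: T] -> nbhs x U ->
  exists K, [/\ clopen K, K x & K `<=` U].
Proof.
move=> hT dT; rewrite nbhsE => -[O [oO Ox] OU].
have QO : quasi_component x `<=` O.
  move=> y Qy; suff -> : y = x by [].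
  have : connected_component setT x y.
    exists (quasi_component x) => //; split => //.
    exact: connected_quasi_component.
  by rewrite dT.
have [K [cK Kx KO]] := quasi_component_clopen oO QO.
by exists K; split => //; exact: subset_trans KO OU.
Qed.

End CompactSpaces.

(** * Open subgroups of profinite groups *)

Definition subgroup (G : zmodType) (H : set G) :=
  H 0 /\ forall x y, H x -> H y -> H (x - y).

Definition addset (G : zmodType) (A B : set G) :=
  [set x | exists2 a, A a & B (x - a)].

Section Subgroups.
Variables (G : zmodType) (H : set G).
Hypothesis sH : subgroup H.

Lemma subgroup0 : H 0. Proof. by case: sH. Qed.

Lemma subgroupB x y : H x -> H y -> H (x - y).
Proof. by case: sH => _; apply. Qed.

Lemma subgroupN x : H x -> H (- x).
Proof. by rewrite -sub0r; apply: subgroupB; exact: subgroup0. Qed.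

Lemma subgroupD x y : H x -> H y -> H (x + y).
Proof. by move=> Hx /subgroupN; rewrite -{2}(opprK y); exact: subgroupB. Qed.

Lemma subgroupMn x n : H x -> H (x *+ n).
Proof.
move=> Hx; elim: n => [|n IH]; first by rewrite mulr0n; exact: subgroup0.
by rewrite mulrS; exact: subgroupD.
Qed.

Lemma subgroupDr x y : H y -> H (x + y) -> H x.
Proof. by move=> Hy Hxy; rewrite -(addrK y x); exact: subgroupB. Qed.

Lemma subgroupDl x y : H y -> H (y + x) -> H x.
Proof. by rewrite addrC; exact: subgroupDr. Qed.

(** By Bezout, [x] is an integral combination of the two multiples. *)
Lemma subgroup_coprime x m n : coprime m n ->
  H (x *+ m) -> H (x *+ n) -> H x.
Proof.
have [->|m0] := posnP m; first by rewrite /coprime gcd0n => /eqP->.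
move=> /eqP co Hm Hn; have [u v uv _] := egcdnP n m0.
apply: (@subgroupDl _ (x *+ n *+ v)); first exact: subgroupMn.
rewrite -mulrnA -[X in _ + X]mulr1n -mulrnDr [(n * v)%N]mulnC.
by rewrite -[1%N]co -uv mulnC mulrnA; exact: subgroupMn.
Qed.

End Subgroups.

Section SubgroupConstructions.
Variable G : zmodType.
Implicit Types A B H : set G.

Lemma subgroupT : subgroup [set: G]. Proof. by []. Qed.

Lemma subgroupI A B : subgroup A -> subgroup B -> subgroup (A `&` B).
Proof.
move=> sA sB; split; first by split; exact: subgroup0.
by move=> x y [Ax Bx] [Ay By]; split; exact: subgroupB.
Qed.

Lemma subgroup_bigcap I (D : set I) (F : I -> set G) :
  (forall i, D i -> subgroup (F i)) -> subgroup (\bigcap_(i in D) F i).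
Proof.
move=> sF; split; first by move=> i /sF /subgroup0.
by move=> x y Fx Fy i Di; apply: subgroupB; [exact: sF|exact: Fx|exact: Fy].
Qed.

Lemma subgroup_preimage (G' : zmodType) (f : {additive G -> G'}) (H' : set G') :
  subgroup H' -> subgroup (f @^-1` H').
Proof.
move=> sH; split; first by rewrite /= raddf0; exact: subgroup0.
by move=> x y /= Hx Hy; rewrite raddfB; exact: subgroupB.
Qed.

Lemma subgroup_addset A B : subgroup A -> subgroup B -> subgroup (addset A B).
Proof.
move=> sA sB; split.
  by exists 0; [exact: subgroup0|rewrite subr0; exact: subgroup0].
move=> x y [a Aa Bxa] [b Ab Byb]; exists (a - b); first exact: subgroupB.
rewrite (_ : _ - _ = (x - a) - (y - b)); first exact: subgroupB.
by rewrite !opprD !opprK addrACA.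
Qed.

Lemma addsetl A B : subgroup B -> A `<=` addset A B.
Proof. by move=> sB x Ax; exists x => //; rewrite subrr; exact: subgroup0. Qed.

Lemma addsetr A B : subgroup A -> B `<=` addset A B.
Proof. by move=> sA x Bx; exists 0; rewrite ?subr0 //; exact: subgroup0. Qed.

End SubgroupConstructions.

Section TopologicalSubgroups.
Variable G : topologicalZmodType.
Implicit Types (A B V : set G) (x y : G).

Lemma addr_continuous x : continuous (fun y : G => y + x).
Proof.
move=> y; apply: (@continuous_comp _ _ _ (fun y => (y, x))
  (fun z : G * G => z.1 + z.2)); last exact: add_continuous.
by apply: cvg_pair => /=; [exact: cvg_id|exact: cvg_cst].
Qed.

Lemma continuous_addr (T : topologicalType) (f g : T -> G) :
  continuous f -> continuous g -> continuous (fun t => f t + g t).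
Proof.
move=> cf cg t; apply: (@continuous_comp _ _ _ (fun t => (f t, g t))
  (fun z : G * G => z.1 + z.2)); last exact: add_continuous.
by apply: cvg_pair => /=; [exact: cf|exact: cg].
Qed.

Lemma continuous_subr (T : topologicalType) (f g : T -> G) :
  continuous f -> continuous g -> continuous (fun t => f t - g t).
Proof.
move=> cf cg; apply: continuous_addr => // t.
by apply: continuous_comp; [exact: cg|exact: opp_continuous].
Qed.

Lemma subr_continuous x : continuous (fun y : G => y - x).
Proof. exact: addr_continuous. Qed.

Lemma rsubr_continuous x : continuous (fun y : G => x - y).
Proof.
by apply: continuous_subr => y; [exact: cvg_cst|exact: cvg_id].
Qed.

Lemma mulrn_continuous n : continuous (fun y : G => y *+ n).
Proof.
elim: n => [|n IH].
  by rewrite (_ : (fun _ => _) = fun=> 0); [move=> x; exact: cvg_cst|apply/funext].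
rewrite (_ : (fun _ => _) = fun y => y + y *+ n); last first.
  by apply/funext => y; rewrite mulrS.
by apply: continuous_addr => // x; exact: cvg_id.
Qed.

Lemma open_preimage (T : topologicalType) (f : G -> T) (A : set T) :
  continuous f -> open A -> open (f @^-1` A).
Proof. by move=> /continuousP; apply. Qed.

Lemma closed_preimage (T : topologicalType) (f : G -> T) (A : set T) :
  continuous f -> closed A -> closed (f @^-1` A).
Proof. by move=> /continuous_closedP; apply. Qed.

Definition open_subgroup V := subgroup V /\ open V.

Lemma subgroup_open V : subgroup V -> nbhs (0 : G) V -> open V.
Proof.
move=> sV V0; rewrite openE => x Vx.
have : nbhs x (fun y => V (y - x)).
  by apply: (@subr_continuous x x); rewrite subrr.
by apply: filterS => y Vyx; rewrite -(subrK x y); exact: subgroupD.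
Qed.

Lemma subgroup_open_sub V A : open_subgroup V -> subgroup A -> V `<=` A ->
  open_subgroup A.
Proof.
move=> [sV oV] sA VA; split => //; apply: subgroup_open => //.
by apply: filterS VA _; apply: open_nbhs_nbhs; split => //; exact: subgroup0.
Qed.

Lemma open_subgroup_closed V : open_subgroup V -> closed V.
Proof.
move=> [sV oV] x cV; have [|y [Vy /= Vyx]] := cV [set y | V (y - x)].
  apply: (@subr_continuous x x); rewrite subrr.
  by apply: open_nbhs_nbhs; split => //; exact: subgroup0.
by rewrite -(subKr y x); exact: subgroupB.
Qed.

Lemma open_subgroupI V V' : open_subgroup V -> open_subgroup V' ->
  open_subgroup (V `&` V').
Proof. by move=> [? ?] [? ?]; split; [exact: subgroupI|exact: openI]. Qed.

End TopologicalSubgroups.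

Section Profinite.
Variable G : topologicalZmodType.
Implicit Types (A B V : set G) (x y : G).
Hypothesis pG : profinite G.

(** [S] is the group of translations preserving a clopen neighbourhood [K] of [0]. It lies in [K]
    because [0] does, and it is open because compactness of [K] makes the condition uniform in
    [k]. *)
Lemma open_subgroup_nbhs A : nbhs (0 : G) A -> exists2 V, open_subgroup V & V `<=` A.
Proof.
case: pG => cG hG dG A0.
have [K [[oK cK] K0 KA]] := compact_clopen_nbhs cG hG dG A0.
pose S := [set g | forall k, K k -> K (k + g) /\ K (k - g)].
have sS : subgroup S.
  split; first by move=> k Kk; rewrite addr0 subr0.
  move=> x y Sx Sy k Kk; rewrite opprB !addrA; split.
    by have [+ _] := Sx _ Kk; case/Sy.
  by rewrite addrAC; have [_] := Sx _ Kk; case/Sy.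
exists S; last by move=> x /(_ _ K0); rewrite add0r => -[/KA].
split => //; apply: subgroup_open => //.
have /compact_near_coveringP cvK : compact K by exact: subclosed_compact cG _.
apply: (cvK G (nbhs (0 : G)) (fun g k => K (k + g) /\ K (k - g))) => k Kk /=.
have Kn : nbhs k K by exact: open_nbhs_nbhs.
have ap := @add_continuous G (k, 0) K; have sp := @sub_continuous G (k, 0) K.
rewrite /= addr0 in ap; rewrite /= subr0 in sp.
by apply: filterI; [exact: ap|exact: sp].
Qed.

Lemma profinite_eq0 x : (forall V, open_subgroup V -> V x) -> x = 0.
Proof.
case: (pG) => _ hG _ Vx; apply/esym/hG => A B A0 Bx.
have [V oV VA] := open_subgroup_nbhs A0.
by exists x; split; [exact: VA (Vx _ oV)|exact: nbhs_singleton].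
Qed.

Lemma open_subgroup_sep A x : closed A -> ~ A x ->
  exists2 V, open_subgroup V & forall y, A y -> ~ V (x - y).
Proof.
move=> cA nAx.
have /open_subgroup_nbhs[V oV VA] : nbhs (0 : G) [set y | ~ A (x - y)].
  apply: (@rsubr_continuous _ x 0 (~` A)); rewrite subr0.
  by apply: open_nbhs_nbhs; split => //; exact: closed_openC.
by exists V => // y Ay /VA /=; rewrite subKr.
Qed.

(** Otherwise the complements of finite unions of cosets of [V] generate a proper filter, and the
    coset of a cluster point [l] meets [I [set l]], a contradiction. *)
Lemma open_subgroup_finite_index V : open_subgroup V ->
  exists2 F : set G, finite_set F & forall x, exists2 y, F y & V (x - y).
Proof.
move=> oV; apply: contrapT => nF.
case: pG => cG hG dG.
pose I (F : set G) := [set x | forall y, F y -> ~ V (x - y)].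
have FF : ProperFilter (filter_from finite_set I).
  apply: filter_from_proper; last first.
    move=> F fF; apply: contrapT => nI; apply: nF; exists F => // x.
    apply: contrapT => nx; apply: nI; exists x => y Fy Vxy; apply: nx.
    by exists y.
  apply: filter_from_filter; first by exists set0; exact: finite_set0.
  move=> A B fA fB; exists (A `|` B); first by rewrite finite_setU.
  by move=> x IAB; split => y Fy; apply: IAB; [left|right].
have [l [_ cl]] := cG _ FF filterT.
have [||y [/= nl Vyl]] := cl (I [set l]) [set y | V (y - l)].
- by exists [set l] => //; exact: finite_set1.
- apply: (@subr_continuous _ l l); rewrite subrr.
  by case: oV => sV oV; apply: open_nbhs_nbhs; split => //; exact: subgroup0.
- exact: nl Vyl.
Qed.

(** The multiples of [x] return infinitely often to the coset [l + V] of a cluster point; two visits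
    differ by a positive multiple of [x] in [V]. *)
Lemma open_subgroup_torsion V x : open_subgroup V ->
  exists2 m, (0 < m)%N & V (x *+ m).
Proof.
move=> [sV oV]; apply: contrapT => nV; case: (pG) => cG _ _.
have [l cl] := cluster_seq cG (fun n => x *+ n).
have oVl : open [set y | V (y - l)].
  by apply: (open_preimage (@subr_continuous _ l)).
have cVl := open_closedC oVl.
have freq N : exists2 n, (N < n)%N & V (x *+ n - l).
  apply: contrapT => nn; have : V (l - l) by rewrite subrr; exact: (subgroup0 sV).
  apply: (cl _ cVl); exists N.+1 => n Nn Vn; apply: nn; exists n => //.
have [n1 _ Vn1] := freq 0%N; have [n2 n12 Vn2] := freq n1.
apply: nV; exists (n2 - n1)%N; first by rewrite subn_gt0.
rewrite mulrnBr; last exact: ltnW.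
by rewrite -(subrK l (x *+ n2)) -addrA -(opprB (x *+ n1)); exact: subgroupB.
Qed.

(** Factorials make the sets [A m] increasing. If none is all of [G], points [u m] outside [A m]
    cluster at some [l] outside every [A m], although [l] has finite order modulo [V]. *)
Lemma open_subgroup_exponent V : open_subgroup V ->
  exists2 m, (0 < m)%N & forall x, V (x *+ m).
Proof.
move=> oV; apply: contrapT => nV; case: (pG) => cG _ _.
pose A m := [set x : G | V (x *+ m`!)].
have /choice[u uA] m : exists x, ~ A m x.
  apply: contrapT => nx; apply: nV; exists m`!; first exact: fact_gt0.
  by move=> x; apply: contrapT => nAx; apply: nx; exists x.
have [l cl] := cluster_seq cG u.
have [m m0 Vlm] := open_subgroup_torsion l oV.
have cA : closed (~` (A m)).
  apply: open_closedC; apply: (open_preimage (@mulrn_continuous _ _)).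
  by case: oV.
apply: (cl _ cA).
  exists m => n mn Am; apply: (uA n); rewrite /A /=.
  rewrite -(ffact_fact (leq_subr m n)) subKn // mulnC mulrnA.
  by apply: subgroupMn => //; case: oV.
have /dvdnP[k kE] : (m %| m`!)%N by apply: dvdn_fact; rewrite m0 leqnn.
by rewrite /A /= kE mulnC mulrnA; apply: subgroupMn => //; case: oV.
Qed.

Lemma closed_compact A : closed A -> compact A.
Proof. by case: (pG) => cG _ _ cA; exact: subclosed_compact cG _. Qed.

Lemma closed_image (G' : topologicalZmodType) (f : G' -> G) (A : set G') :
  profinite G' -> continuous f -> closed A -> closed (f @` A).
Proof.
move=> [cG' _ _] cf cA; case: (pG) => cG hG _.
apply: compact_closed => //; apply: continuous_compact.
  by apply: continuous_subspaceT.
exact: subclosed_compact cG' _.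
Qed.

Lemma closed_addset A B : closed A -> closed B -> closed (addset A B).
Proof.
move=> cA cB; rewrite (_ : addset A B =
  (fun z : G * G => z.1 + z.2) @` (A `*` B)); last first.
  apply/seteqP; split => [x [a Aa Bxa]|_ [[a b] [Aa Bb] <-]] /=.
    by exists (a, x - a) => //=; rewrite addrC subrK.
  by exists a => //; rewrite addrC addKr.
case: (pG) => cG hG _.
apply: compact_closed => //; apply: continuous_compact.
  by apply: continuous_subspaceT; exact: add_continuous.
by apply: compact_setX; exact: closed_compact.
Qed.

End Profinite.

(** * Primary decomposition *)

Section PrimaryParts.
Variable G : topologicalZmodType.
Implicit Types (A B V : set G) (x y : G).

Definition multiples n : set G := [set x *+ n | x in [set: G]].

Definition divisible_part p : set G := \bigcap_n multiples (p ^ n).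

Definition primary_mod V p : set G := [set x | exists n, V (x *+ p ^ n)].

(** For prime [p] and profinite [G] this is the Sylow pro-[p] subgroup, described without forming
    the quotients [G / V]. *)
Definition primary_part p : set G :=
  \bigcap_(V in @open_subgroup G) primary_mod V p.

Lemma subgroup_multiples n : subgroup (multiples n).
Proof.
split; first by exists 0; rewrite ?mul0rn.
by move=> _ _ [x _ <-] [y _ <-]; exists (x - y); rewrite ?mulrnBl.
Qed.

Lemma subgroup_divisible_part p : subgroup (divisible_part p).
Proof. by apply: subgroup_bigcap => n _; exact: subgroup_multiples. Qed.

Lemma subgroup_primary_mod V p : subgroup V -> subgroup (primary_mod V p).
Proof.
move=> sV; split; first by exists 0%N; rewrite mul0rn; exact: subgroup0.
move=> x y [m Vx] [n Vy]; exists (m + n)%N.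
rewrite expnD mulrnBl {2}mulnC !mulrnA.
by apply: subgroupB => //; exact: subgroupMn.
Qed.

Lemma open_primary_mod V p : open_subgroup V -> open_subgroup (primary_mod V p).
Proof.
move=> oV; apply: (subgroup_open_sub oV) => [|x Vx]; last by exists 0%N.
by apply: subgroup_primary_mod; case: oV.
Qed.

Lemma subgroup_primary_part p : subgroup (primary_part p).
Proof.
by apply: subgroup_bigcap => V [sV _]; exact: subgroup_primary_mod.
Qed.

Lemma closed_primary_part p : closed (primary_part p).
Proof.
by apply: closed_bigI => V oV; apply: open_subgroup_closed; exact: open_primary_mod.
Qed.

Lemma primary_part_torsion p n x : x *+ p ^ n = 0 -> primary_part p x.
Proof. by move=> x0 V [sV _]; exists n; rewrite x0; exact: subgroup0. Qed.

Hypothesis pG : profinite G.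

Lemma closed_multiples n : closed (multiples n).
Proof.
apply: (closed_image pG pG); last exact: closedT.
exact: mulrn_continuous.
Qed.

Lemma closed_divisible_part p : closed (divisible_part p).
Proof. by apply: closed_bigI => n _; exact: closed_multiples. Qed.

Lemma open_subgroup_prime_exponent V p : prime p -> open_subgroup V ->
  exists a m, [/\ (0 < m)%N, coprime p m & forall x, V (x *+ (p ^ a * m))].
Proof.
move=> pp oV; have [M M0 VM] := open_subgroup_exponent pG oV.
have [m cop EM] := pfactor_coprime pp M0.
exists (logn p M), m; split => //; last by move=> x; rewrite mulnC -EM.
by move: M0; rewrite EM muln_gt0 => /andP[].
Qed.

(** Modulo [V], [x] is killed by a power of [p] and, being [p ^ a] times an element, also by [m],
    which is prime to [p]. *)
Lemma divisible_primary_part0 p x : prime p ->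
  divisible_part p x -> primary_part p x -> x = 0.
Proof.
move=> pp Dx Ex; apply: (profinite_eq0 pG) => V oV.
have [a [m [m0 cop Vm]]] := open_subgroup_prime_exponent pp oV.
have [n Vn] := Ex V oV; have [y _ yx] := Dx a I.
have [sV _] := oV; apply: (subgroup_coprime sV _ _ Vn).
  by apply: (coprimeXr n); rewrite coprime_sym; exact: cop.
by rewrite -yx -mulrnA.
Qed.

Lemma primary_parts0 p q x : prime p -> prime q -> p != q ->
  primary_part p x -> primary_part q x -> x = 0.
Proof.
move=> pp pq npq Ep Eq; apply: (profinite_eq0 pG) => V oV.
have [m Vm] := Ep V oV; have [n Vn] := Eq V oV.
have [sV _] := oV; apply: (subgroup_coprime sV _ Vm Vn).
by apply/coprimeXl/coprimeXr; rewrite prime_coprime // dvdn_prime2.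
Qed.

(* On a finite quotient of order [p ^ a * m], multiplication by [p ^ k`!] is for
   large [k] the projection onto the part of order prime to [p]. *)
Lemma divisible_primary_partD p x : prime p ->
  addset (divisible_part p) (primary_part p) x.
Proof.
move=> pp; have [cG _ _] := pG.
have [l cl] := cluster_seq cG (fun k => x *+ p ^ k`!).
exists l => [n _|V oV].
  apply: (cl _ (@closed_multiples _)); exists n => k nk.
  exists (x *+ p ^ (k`! - n)) => //.
  rewrite -mulrnA -expnD subnK // (leq_trans nk) //.
  by case: k {nk} => // k; apply: dvdn_leq; rewrite ?fact_gt0 // dvdn_fact ?leqnn.
have [sV _] := oV.
have cC : closed [set y | primary_mod V p (x - y)].
  apply: (closed_preimage (@rsubr_continuous _ x)).
  by apply: open_subgroup_closed; exact: open_primary_mod.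
apply: (cl _ cC).
have [a [m [m0 cop Vm]]] := open_subgroup_prime_exponent pp oV.
(* Once [totient m] divides the exponent, Euler's theorem makes [m] divide that power of [p] minus
   1, so [p ^ a] kills the difference modulo [V]. *)
exists (totient m) => k mk; exists a.
rewrite -opprB mulNrn; apply: subgroupN => //.
have /dvdnP[t tE] : (m %| p ^ k`! - 1)%N.
  rewrite -eqn_mod_dvd ?expn_gt0 ?prime_gt0 //.
  have /dvdnP[j ->] : (totient m %| k`!)%N.
    by apply: dvdn_fact; rewrite totient_gt0 m0.
  rewrite mulnC expnM -modnXm cyclic.Euler_exp_totient // modnXm exp1n //.
rewrite -{2}(mulr1n x) -mulrnBr ?expn_gt0 ?prime_gt0 // tE -mulrnA.
by rewrite -mulnA [(m * _)%N]mulnC mulnC mulrnA; exact: subgroupMn.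
Qed.

End PrimaryParts.

Lemma divisible_part_hom (G G' : topologicalZmodType) (f : {additive G -> G'})
  p x : divisible_part p x -> divisible_part p (f x).
Proof.
by move=> Dx n _; have [y _ <-] := Dx n I; exists (f y); rewrite ?raddfMn.
Qed.

Lemma primary_part_hom (G G' : topologicalZmodType) (f : {additive G -> G'})
  p x : continuous f -> primary_part p x -> primary_part p (f x).
Proof.
move=> cf Ex V [sV oV].
have oV' : open_subgroup (f @^-1` V).
  by split; [exact: subgroup_preimage|exact: open_preimage].
by have [n Vn] := Ex _ oV'; exists n; rewrite -raddfMn.
Qed.

(** * Splitting off a direct factor *)

Section CyclicExtensions.
Variable G : zmodType.
Implicit Types (V M K : set G) (x y : G).

(** Only natural multiples of [y] occur; this is the subgroup [V + <y>] once some positive multiple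
    of [y] lies in the subgroup [V]. *)
Definition cyclic_ext V y : set G := [set z | exists j : nat, V (z - y *+ j)].

Lemma cyclic_ext_sub V y : V `<=` cyclic_ext V y.
Proof. by move=> x Vx; exists 0%N; rewrite subr0. Qed.

Lemma subgroup_cyclic_ext V y m : subgroup V -> (0 < m)%N -> V (y *+ m) ->
  subgroup (cyclic_ext V y).
Proof.
move=> sV m0 Vym; split; first by apply: cyclic_ext_sub; exact: subgroup0.
(* Modulo [V], [- j y] equals [(m - 1) j y]. *)
move=> z w [i Vz] [j Vw]; exists (i + m.-1 * j)%N.
rewrite (_ : _ - _ = (z - y *+ i) - (w - y *+ j) - y *+ m *+ j).
  by apply: subgroupB => //; [exact: subgroupB|exact: subgroupMn].
rewrite -mulrnA -{2}(prednK m0) mulSn !mulrnDr !opprD opprK !addrA.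
by rewrite addrK [z - y *+ i - w]addrAC.
Qed.

(** Take [V] maximal between [K] and [M] without [x *+ p ^ n]. This forces that [y] lies in
    [V + <x>] whenever [p y] does; descend from [p ^ (n+1) y] in [K]. *)
Lemma max_subgroup M K p n x : prime p -> subgroup M -> subgroup K ->
  K `<=` M -> M x -> (forall y, M y -> K (y *+ p ^ n.+1)) ->
  ~ K (x *+ p ^ n) ->
  exists V, [/\ subgroup V, K `<=` V, V `<=` M, ~ V (x *+ p ^ n)
              & M `<=` cyclic_ext V x].
Proof.
move=> pp sM sK KM Mx MK nKx.
pose Q V := [/\ subgroup V, K `<=` V, V `<=` M & ~ V (x *+ p ^ n)].
have QK : Q K by split.
have [|V [QV maxV]] := @Zorn_bigcup G (fun V => V = set0 \/ Q V).
  move=> F FQ totF; have [F0|/nonemptyPn] := pselect (\bigcup_(X in F) X = set0).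
    by left.
  move/contrapT => [z [X0 FX0 X0z]]; right.
  have Qne X w : F X -> X w -> Q X by move=> /FQ[->|].
  have [sX0 KX0 X0M nX0] := Qne _ _ FX0 X0z.
  split.
  - split; first by exists X0 => //; exact: subgroup0.
    move=> a b [X FX Xa] [Y FY Yb].
    have [sX _ _ _] := Qne _ _ FX Xa; have [sY _ _ _] := Qne _ _ FY Yb.
    have [XY|YX] := totF _ _ FX FY.
      by exists Y => //; apply: subgroupB => //; exact: XY.
    by exists X => //; apply: subgroupB => //; exact: YX.
  - by move=> w /KX0 X0w; exists X0.
  - by move=> w [X FX Xw]; have [_ _ XM _] := Qne _ _ FX Xw; exact: XM.
  - by move=> [X FX Xw]; have [_ _ _] := Qne _ _ FX Xw; apply.
have {QV} [sV KV VM nVx] : Q V.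
  case: QV => // V0; exfalso; apply: (maxV K); last by right.
  by rewrite V0; split=> // /(_ 0 (subgroup0 sK)).
have p0 := prime_gt0 pp.
have Vxp : V (x *+ p ^ n *+ p) by rewrite -mulrnA -expnSr; exact/KV/MK.
(* Multiplying by [p ^ n] shows that [p] divides [k], so [y' = y - k' x] has [p y'] in [V]. If [y']
   is not in [V], maximality puts [x *+ p ^ n] in [V + <y'>]. *)
have step y : M y -> cyclic_ext V x (y *+ p) -> cyclic_ext V x y.
  move=> My [k Vk].
  have Vxk : V (x *+ p ^ n *+ k).
    rewrite mulrnAC; have := subgroupMn sV (p ^ n)%N Vk.
    rewrite mulrnBl -(mulrnA y) -expnS; have := KV _ (MK _ My).
    by move=> Vy /(subgroupB sV Vy); rewrite subKr.
  have /dvdnP[k' kE] : (p %| k)%N.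
    apply: contrapT => /negP; rewrite -prime_coprime // => co.
    exact/nVx/(subgroup_coprime sV co).
  pose y' := y - x *+ k'.
  have Vy'p : V (y' *+ p) by rewrite mulrnBl -mulrnA -kE.
  have My' : M y' by apply: subgroupB => //; exact: subgroupMn.
  have sX := subgroup_cyclic_ext sV p0 Vy'p.
  have [Vy'|nVy'] := pselect (V y'); first by exists k'.
  have [j Vj] : cyclic_ext V y' (x *+ p ^ n).
    apply: contrapT => nX; apply: (maxV (cyclic_ext V y')).
      split; first exact: cyclic_ext_sub.
      move=> /(_ y') VX; apply/nVy'/VX; exists 1%N.
      by rewrite subrr; exact: subgroup0.
    right; split => //; first by move=> z /KV; exact: cyclic_ext_sub.
    move=> z [i /VM Mz]; rewrite -(subrK (y' *+ i) z).
    by apply: subgroupD => //; exact: subgroupMn.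
  have co : coprime j p.
    rewrite coprime_sym prime_coprime //; apply/negP => /dvdnP[i iE].
    apply: nVx; rewrite -(subrK (y' *+ j) (x *+ _)).
    by apply: subgroupD => //; rewrite iE mulnC mulrnA; exact: subgroupMn.
  (* Modulo [V + <x>] both [p y'] and [j y'] vanish. *)
  have sVx : subgroup (cyclic_ext V x).
    apply: (subgroup_cyclic_ext (m := (p ^ n.+1)%N)) => //.
      by rewrite expn_gt0 p0.
    exact/KV/MK.
  have Xx : cyclic_ext V x x by exists 1%N; rewrite subrr; exact: subgroup0.
  have Xy' : cyclic_ext V x y'.
    apply: (subgroup_coprime sVx co); last exact: cyclic_ext_sub.
    rewrite -(subKr (x *+ p ^ n) (y' *+ j)).
    by apply: subgroupB => //; [exact: subgroupMn|exact: cyclic_ext_sub].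
  rewrite -(subrK (x *+ k') y); apply: subgroupD => //; exact: subgroupMn.
exists V; split => // y My.
have : cyclic_ext V x (y *+ p ^ n.+1) by apply/cyclic_ext_sub/KV/MK.
elim: n.+1 => [|i IH]; first by rewrite expn0.
rewrite expnSr mulrnA => /step; move=> /(_ (subgroupMn sM _ My)); exact: IH.
Qed.

End CyclicExtensions.

(** * Projections onto closed direct factors *)

Section Projection.
Variable G : topologicalZmodType.
Hypothesis pG : profinite G.
Variables A B : set G.
Hypotheses (sA : subgroup A) (sB : subgroup B) (cA : closed A) (cB : closed B).
Hypothesis AB0 : forall x, A x -> B x -> x = 0.
Hypothesis ABT : forall x, addset A B x.

(** Continuity: the preimage of a closed [Z] is the sum of the intersection of [Z] and [A] with [B],
    closed by compactness. *)
Lemma projection_along : exists e : {additive G -> G},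
  [/\ continuous e, (forall x, A (e x)) & (forall x, B (x - e x))]
  /\ (forall a, A a -> e a = a) /\ (forall b, B b -> e b = 0).
Proof.
have /choice[e eAB] x : exists a, A a /\ B (x - a).
  by have [a Aa Ba] := ABT x; exists a.
have eE x a : A a -> B (x - a) -> e x = a.
  move=> Aa Ba; have [Ae Be] := eAB x; apply/eqP; rewrite -subr_eq0; apply/eqP.
  apply: AB0; first exact: subgroupB.
  rewrite (_ : _ - _ = (x - a) - (x - e x)); first exact: subgroupB.
  by rewrite opprB [RHS]addrC addrA subrK.
have eB : {morph e : x y / x - y}.
  move=> x y; have [Ax Bx] := eAB x; have [Ay By] := eAB y.
  apply: eE; first exact: subgroupB.
  rewrite (_ : _ - _ = (x - e x) - (y - e y)); first exact: subgroupB.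
  by rewrite !opprD !opprK addrACA.
pose e' : {additive G -> G} := HB.pack e (GRing.isZmodMorphism.Build G G e eB).
exists e'; split; last first.
  split => [a Aa|b Bb] /=; apply: eE => //.
  - by rewrite subrr; exact: subgroup0.
  - exact: subgroup0.
  - by rewrite subr0.
split; [|by move=> x; case: (eAB x)..].
apply/continuous_closedP => Z cZ.
rewrite (_ : _ @^-1` _ = addset (Z `&` A) B).
  by apply: (closed_addset pG) => //; exact: closedI.
apply/seteqP; split => [x /= Zx|x [a [Za Aa] Ba]].
  by have [Ax Bx] := eAB x; exists (e x).
by rewrite /= (eE x a).
Qed.

End Projection.

Definition idempotent_endo (G : topologicalZmodType) (r : {additive G -> G}) :=
  continuous r /\ forall x, r (r x) = r x.

(** The relations with [r] make the image of [e] a direct factor of the image of [r], and [r - e]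
    idempotent again if [r] is. *)
Definition splits_off (G : topologicalZmodType) (r e : {additive G -> G})
    (U : set G) :=
  [/\ idempotent_endo e, (forall x, r (e x) = e x), (forall x, e (r x) = e x),
      (forall x, U (e x)) & exists x, e x != 0].

(** The image of [H] in [G / pG] is finite; for a direct factor [H] this image is [H / pH]. *)
Definition finite_mod (G : topologicalZmodType) p (H : set G) :=
  exists2 F : set G, finite_set F &
    forall x, H x -> exists2 y, F y & multiples p (x - y).

Section FiniteMod.
Variables (G : topologicalZmodType) (p : nat).
Implicit Types A B C : set G.

Lemma finite_mod_trans A B :
  (forall x, A x -> exists2 y, B y & multiples p (x - y)) ->
  finite_mod p B -> finite_mod p A.
Proof.
move=> AB [F fF FB]; exists F => // x /AB[y /FB[z Fz yz] xy]; exists z => //.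
rewrite -(subrK y x) -addrA; apply: subgroupD => //; exact: subgroup_multiples.
Qed.

Lemma finite_mod_add A B C : finite_mod p B -> finite_mod p C ->
  A `<=` addset B C -> finite_mod p A.
Proof.
move=> [F fF FB] [F' fF' FC] ABC; exists [set x + y | x in F & y in F'].
  exact: finite_image2.
move=> x /ABC[b /FB[f Ff bf] /FC[f' Ff' cf']].
exists (f + f'); first by exists f => //; exists f'.
rewrite (_ : _ - _ = (x - b - f') + (b - f)).
  by apply: subgroupD => //; exact: subgroup_multiples.
by rewrite addrACA subrK opprD [- f' - f]addrC.
Qed.

Lemma finite_mod_finite (F : set G) : finite_set F -> finite_mod p F.
Proof.
move=> fF; exists F => // x Fx; exists x => //; rewrite subrr.
by apply: subgroup0; exact: subgroup_multiples.
Qed.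

End FiniteMod.

Section SplittingOff.
Variable G : topologicalZmodType.
Hypothesis pG : profinite G.
Implicit Types (x y z : G) (A B V W : set G).

Lemma closed_finite (F : set G) : finite_set F -> closed F.
Proof.
by case: pG => _ hG _ fF; apply: compact_closed => //; exact: finite_compact.
Qed.

Variable r : {additive G -> G}.
Hypothesis ir : idempotent_endo r.
Notation fixr := [set x | r x = x].
Notation kerr := [set x | r x = 0].

Lemma subgroup_fix : subgroup fixr.
Proof.
split; first exact: raddf0.
by move=> x y /= xE yE; rewrite raddfB xE yE.
Qed.

Lemma closed_fix : closed fixr.
Proof.
case: ir => cr rr; rewrite (_ : fixr = r @` setT).
  by apply: (closed_image pG pG cr); exact: closedT.
by apply/seteqP; split => [x <-|_ [x _ <-]] //=; exists x.
Qed.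

Lemma subgroup_ker : subgroup kerr.
Proof.
split; first exact: raddf0.
by move=> x y /= xE yE; rewrite raddfB xE yE subrr.
Qed.

Lemma closed_ker : closed kerr.
Proof.
case: ir => cr _; rewrite (_ : kerr = r @^-1` [set 0]) //.
by apply: closed_preimage => //; apply: closed_finite; exact: finite_set1.
Qed.

Lemma ker_sub x : kerr (x - r x).
Proof. by case: ir => _ rr; rewrite /= raddfB rr subrr. Qed.

(** [e] is the projection onto [A] along [B]; it satisfies [e r = e] because [x - r x] lies in the
    kernel of [r], hence in [B]. *)
Lemma splits_off_subgroups U A B :
  subgroup A -> subgroup B -> closed A -> closed B ->
  (forall x, A x -> B x -> x = 0) -> (forall x, addset A B x) ->
  A `<=` U -> A `<=` fixr -> kerr `<=` B -> (exists2 x, A x & x != 0) ->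
  exists2 e, splits_off r e U & forall x, A (e x).
Proof.
move=> sA sB cA cB AB0 ABT AU Ar rB [x0 Ax0 x00].
have [e [[ce Ae Be] [eA eB]]] := projection_along pG sA sB cA cB AB0 ABT.
exists e => //; split.
- by split => // x; rewrite eA.
- by move=> x; rewrite [LHS]Ar.
- move=> x; apply/eqP; rewrite eq_sym -subr_eq0 -raddfB; apply/eqP.
  by apply: eB; apply: rB; exact: ker_sub.
- by move=> x; exact: AU.
- by exists x0; rewrite eA.
Qed.

(** The complement is the preimage of [D_p] under [r], which contains the kernel of [r]. Since [r]
    preserves both [D_p] and [E_p], the decomposition of [G] restricts. *)
Lemma splits_off_primary p U : prime p -> primary_part p `<=` U ->
  (exists2 x, primary_part p x & r x = x /\ x != 0) ->
  exists2 e, splits_off r e U & forall x, primary_part p (e x).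
Proof.
move=> pp EU [x0 Ex0 [rx0 x00]]; have [cr rr] := ir.
have [||||||||||e se Ee] := @splits_off_subgroups U (primary_part p `&` fixr)
    (r @^-1` (divisible_part p)).
- by apply: subgroupI; [exact: subgroup_primary_part|exact: subgroup_fix].
- exact/subgroup_preimage/subgroup_divisible_part.
- by apply: closedI; [exact: closed_primary_part|exact: closed_fix].
- by apply: closed_preimage => //; exact: closed_divisible_part.
- move=> x [Ex /= rx]; rewrite rx => Dx.
  exact: (divisible_primary_part0 pG pp).
- move=> x; have [d Dd Ed] := divisible_primary_partD pG x pp.
  exists (r (x - d)).
    by split; [exact: primary_part_hom|exact: rr].
  rewrite /= raddfB rr raddfB subKr; exact: divisible_part_hom.
- by move=> x [/EU].
- by move=> x [].
- move=> x /= ->; by apply: subgroup0; exact: subgroup_divisible_part.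
- by exists x0.
by exists e => // x; have [] := Ee x.
Qed.

Section FiniteCyclic.
Variables (p n : nat) (x : G) (U : set G).
Hypotheses (pp : prime p) (sU : subgroup U) (Ux : U x) (rx : r x = x).
Hypotheses (xp : x *+ p ^ n.+1 = 0) (nx : ~ multiples (p ^ n.+1) (x *+ p ^ n)).

(** Including the kernel of [r] in [K] makes the complement of [<x>] compatible with [r]; adding an
    open [W] that still keeps [x *+ p ^ n] out makes it open, hence closed. *)
Lemma splits_off_finite_cyclic :
  exists2 e, splits_off r e U & finite_mod p [set e x | x in [set: G]].
Proof.
have [cr rr] := ir.
pose K := addset (multiples (p ^ n.+1)) kerr.
have sK : subgroup K.
  by apply: subgroup_addset; [exact: subgroup_multiples|exact: subgroup_ker].
have cK : closed K.
  by apply: (closed_addset pG); [exact: (closed_multiples pG)|exact: closed_ker].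
have nKx : ~ K (x *+ p ^ n).
  move=> [_ [y _ <-]]; rewrite /= raddfB !(raddfMn r) rx => /eqP.
    by rewrite subr_eq0 => /eqP xy; apply: nx; exists (r y).
have [W oW WK] := open_subgroup_sep pG cK nKx; have [sW _] := oW.
have sKW := subgroup_addset sK sW.
have [||V [sV KV _ nVx VT]] := max_subgroup (n := n) pp (subgroupT G) sKW
    (@subsetT _ _) (I : [set: G] x).
- move=> y _; apply: addsetl => //; apply: addsetl; first exact: subgroup_ker.
  by exists y.
- by move=> [y Ky Wy]; exact: (WK y).
have oV : open_subgroup V.
  by apply: (subgroup_open_sub oW) => // w Ww; apply/KV/addsetr.
have N0 : (0 < p ^ n.+1)%N by rewrite expn_gt0 prime_gt0.
pose A := cyclic_ext [set 0] x.
have sA : subgroup A.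
  apply: (subgroup_cyclic_ext (m := (p ^ n.+1)%N)) => //.
  by split => // a b -> ->; rewrite subrr.
have AE z : A z -> exists j, z = x *+ j.
  by move=> [j /eqP]; rewrite subr_eq0 => /eqP; exists j.
have fA : finite_set A.
  apply: (sub_finite_set _ (finite_image (fun j => x *+ j) (finite_II (p ^ n.+1)))).
  move=> z /AE[j ->]; exists (j %% p ^ n.+1)%N; first by rewrite /= ltn_pmod.
  rewrite [in RHS](divn_eq j (p ^ n.+1)) mulrnDr mulnC mulrnA xp mul0rn.
  by rewrite add0r.
have [||||||e se Ae] := @splits_off_subgroups U A V sA sV
    (closed_finite fA) (open_subgroup_closed oV).
(* Write [j = m p ^ a] with [m] prime to [p]. If [a > n] then [j x = 0]; otherwise cancelling [m]
   puts [p ^ a x], hence [p ^ n x], in [V]. *)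
- move=> z /AE[j ->] Vj; have [-> //|j0] := posnP j.
  have [m cop jE] := pfactor_coprime pp j0.
  set a := logn p j in jE; have [na|an] := ltnP n a.
    by rewrite jE mulnC -(subnK na) expnD -mulnA mulnC -mulnA mulrnA xp mul0rn.
  exfalso; apply: nVx; rewrite -(subnKC an) expnD mulrnA.
  apply: subgroupMn => //.
  apply: (subgroup_coprime sV (m := m) (n := (p ^ n.+1)%N)).
  + by apply: coprimeXr; rewrite coprime_sym.
  + by rewrite -mulrnA mulnC -jE.
  + by rewrite mulrnAC xp mul0rn; exact: subgroup0.
- move=> z; have [//|j Vj] := VT z; exists (x *+ j) => //.
  by exists j; rewrite subrr.
- by move=> z /AE[j ->]; exact: subgroupMn.
- by move=> z /AE[j ->]; rewrite /= raddfMn rx.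
- move=> z rz; apply: KV; apply: addsetl => //.
  by apply: addsetr => //; exact: subgroup_multiples.
- exists x; first by exists 1%N; rewrite subrr.
  apply/eqP => x0; apply: nx; rewrite x0 mul0rn.
  by apply: subgroup0; exact: subgroup_multiples.
exists e => //; exists A => // _ [y _ <-]; exists (e y) => //.
by rewrite subrr; apply: subgroup0; exact: subgroup_multiples.
Qed.

End FiniteCyclic.

End SplittingOff.

(** * Splitting off a procyclic factor *)

Section ProcyclicFactor.
Variable G : topologicalZmodType.
Hypothesis pG : profinite G.
Implicit Types (x y z : G) (A B V W : set G).

Lemma finite_index_sub U A : open_subgroup U -> exists2 F : set G, finite_set F &
  F `<=` A /\ forall x, A x -> exists2 y, F y & U (x - y).
Proof.
move=> oU; have [F fF FU] := open_subgroup_finite_index pG oU.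
have [sU _] := oU.
have /choice[t tP] y : exists t, (exists2 x, A x & U (x - y)) -> A t /\ U (t - y).
  have [[x Ax Uxy]|nx] := pselect (exists2 x, A x & U (x - y)); first by exists x.
  by exists 0.
(* The default [0], given to cosets that miss [A], need not lie in [A]; hence the intersection. *)
exists (t @` F `&` A); first by apply: finite_setIl; exact: finite_image.
split=> [x []//|x Ax]; have [y Fy Uxy] := FU x.
have [At Ut] := tP y (ex_intro2 _ _ x Ax Uxy).
exists (t y); first by split => //; exists y.
rewrite (_ : _ - _ = (x - y) - (t y - y)); first exact: subgroupB.
by rewrite opprB addrA subrK.
Qed.

(* The closure of the cyclic group generated by [x]. *)
Definition procyclic x : set G :=
  \bigcap_(W in @open_subgroup G) cyclic_ext W x.

Lemma open_cyclic_ext W x : open_subgroup W -> open_subgroup (cyclic_ext W x).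
Proof.
move=> oW; have [m m0 Wm] := open_subgroup_torsion pG x oW.
apply: (subgroup_open_sub oW); last exact: cyclic_ext_sub.
by case: oW => sW _; exact: subgroup_cyclic_ext sW m0 Wm.
Qed.

Lemma subgroup_procyclic x : subgroup (procyclic x).
Proof. by apply: subgroup_bigcap => W /(@open_cyclic_ext _ x)[]. Qed.

Lemma closed_procyclic x : closed (procyclic x).
Proof.
apply: closed_bigI => W /(@open_cyclic_ext _ x); exact: open_subgroup_closed.
Qed.

Lemma procyclic_mem x n : procyclic x (x *+ n).
Proof. by move=> W [sW _]; exists n; rewrite subrr; exact: subgroup0. Qed.

Lemma procyclic_min x A : closed A -> (forall n, A (x *+ n)) -> procyclic x `<=` A.
Proof.
move=> cA Ax z Cz; apply: contrapT => nAz.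
have [W oW WA] := open_subgroup_sep pG cA nAz.
by have [j /(WA _ (Ax j))] := Cz W oW.
Qed.

(** The multiples [j x] with [j < p], together with [pG], sum to a closed set containing all
    multiples of [x], hence their closure. *)
Lemma procyclic_finite_mod x p : (0 < p)%N -> finite_mod p (procyclic x).
Proof.
move=> p0; pose F := (fun j => x *+ j) @` `I_p.
have fF : finite_set F by apply: finite_image; exact: finite_II.
exists F => // z; suff : procyclic x `<=` addset F (multiples p) by apply.
apply: procyclic_min => [|j].
  apply: (closed_addset pG); first exact: (closed_finite pG).
  exact: (closed_multiples pG).
exists (x *+ (j %% p)); first by exists (j %% p)%N => //=; rewrite ltn_pmod.
rewrite {1}(divn_eq j p) mulrnDr addrK; exists (x *+ (j %/ p)) => //.
by rewrite -mulrnA.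
Qed.

Variables (r : {additive G -> G}) (p : nat) (U : set G).
Hypotheses (ir : idempotent_endo r) (pp : prime p) (oU : open_subgroup U).
Hypothesis nfr : ~ finite_mod p [set x | r x = x].
(* No finite cyclic subgroup of [U] can be split off. *)
Hypothesis noU : forall n x, U x -> r x = x -> x *+ p ^ n.+1 = 0 ->
  multiples (p ^ n.+1) (x *+ p ^ n).

Let rr x : r (r x) = r x. Proof. by case: ir. Qed.
Let sU : subgroup U. Proof. by case: oU. Qed.

Definition torsion n : set G := [set x | r x = x /\ x *+ p ^ n = 0].

Lemma subgroup_torsion n : subgroup (torsion n).
Proof.
split; first by rewrite /torsion /= raddf0 mul0rn.
move=> x y [rx xn] [ry yn]; rewrite /torsion /= raddfB rx ry mulrnBl xn yn.
by rewrite subrr.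
Qed.

Lemma closed_torsion n : closed (torsion n).
Proof.
rewrite (_ : torsion n =
  [set x | r x = x] `&` (fun x => x *+ p ^ n) @^-1` [set 0]) //.
apply: closedI; first exact: (closed_fix pG ir).
apply: (closed_preimage (@mulrn_continuous _ _)).
by apply: (closed_finite pG); exact: finite_set1.
Qed.

Lemma torsion_sub m n : (m <= n)%N -> torsion m `<=` torsion n.
Proof.
move=> mn x [rx xm]; split => //.
by rewrite -(subnK mn) expnD mulnC mulrnA xm mul0rn.
Qed.

(** The open subgroups [torsion n + U] increase to an open, hence closed and compact, subgroup, so
    they become stationary. *)
Lemma torsion_stable : exists N, forall n, torsion n `<=` addset (torsion N) U.
Proof.
pose S n := addset (torsion n) U.
have sS n : subgroup (S n) by apply: subgroup_addset => //; exact: subgroup_torsion.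
have oS n : open_subgroup (S n).
  by apply: (subgroup_open_sub oU) => //; apply: addsetr; exact: subgroup_torsion.
have SS m n : (m <= n)%N -> S m `<=` S n.
  by move=> /torsion_sub mn x [t /mn Tt Ux]; exists t.
pose S' := \bigcup_n S n.
have oS' : open_subgroup S'.
  apply: (subgroup_open_sub oU); last first.
    by move=> x Ux; exists 0%N => //; apply: addsetr => //; exact: subgroup_torsion.
  split; first by exists 0%N => //; exact: subgroup0.
  move=> x y [m _ Sx] [n _ Sy]; exists (maxn m n) => //.
  apply: subgroupB => //; first exact: SS (leq_maxl _ _) _ Sx.
  exact: SS (leq_maxr _ _) _ Sy.
apply: contrapT => nN.
have /choice[u uP] N : exists x, S' x /\ ~ S N x.
  apply: contrapT => nx; apply: nN; exists N => n x Tx.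
  apply: contrapT => nSx; apply: nx; exists x; split => //.
  by exists n => //; apply: addsetl.
have [cG _ _] := pG; have [l cl] := cluster_seq cG u.
have [|m _ Sl] := cl _ (open_subgroup_closed oS').
  by exists 0%N => n _; have [] := uP n.
apply: (cl (~` S m)) Sl; first by apply: open_closedC; case: (oS m).
by exists m => n mn Sm; have [_] := uP n; apply; exact: SS Sm.
Qed.

(** From [N] on, torsion elements can be moved into [U] modulo [torsion N], and [noU] gains a factor
    [p]. So an element fixed by [r], killed by [p] and divisible by [p ^ N] is divisible by all
    powers of [p], and vanishes as an element of both [D_p] and [E_p]. This applies to
    [x *+ p ^ N]. *)
Lemma torsion_bounded : exists N, torsion N.+1 `<=` torsion N.
Proof.
have [N NU] := torsion_stable; exists N.
have div n x : (N <= n)%N -> torsion n.+1 x -> multiples (p ^ n.+1) (x *+ p ^ n).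
  move=> Nn Tx; have [t Tt Ut] := NU _ _ Tx.
  have [rt tn] := torsion_sub Nn Tt.
  have [_ tn'] := torsion_sub (leq_trans Nn (leqnSn n)) Tt.
  have [rx xn] := Tx.
  rewrite (_ : x *+ _ = (x - t) *+ p ^ n); last by rewrite mulrnBl tn subr0.
  by apply: noU => //; rewrite ?raddfB ?rx ?rt // mulrnBl xn tn' subrr.
have E0 y : r y = y -> y *+ p = 0 -> multiples (p ^ N) y -> y = 0.
  move=> ry yp Ny; apply: (divisible_primary_part0 pG pp); last first.
    by apply: (@primary_part_torsion _ p 1); rewrite expn1.
  have Dy n : (N <= n)%N -> multiples (p ^ n) y.
    elim: n => [|n IH]; first by rewrite leqn0 => /eqP <-.
    rewrite leq_eqVlt => /predU1P[<- //|]; rewrite ltnS => Nn.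
    have [z _ zy] := IH Nn.
    have zE : r z *+ p ^ n = y by rewrite -raddfMn zy ry.
    rewrite -zE; apply: div => //; split; first exact: rr.
    by rewrite expnSr mulrnA zE.
  move=> n _; have [/Dy //|/ltnW nN] := leqP N n.
  have [z _ <-] := Ny; exists (z *+ p ^ (N - n)) => //.
  by rewrite -mulrnA -expnD subnK.
move=> x [rx xN]; split => //; apply: E0.
- by rewrite raddfMn rx.
- by rewrite -mulrnA -expnSr.
- by exists x.
Qed.

(** For [u] in [U] and [torsion n.+1], [noU] gives [g] with [u - p r(g)] in [torsion n]. So modulo
    [pG] only finitely many cosets of [U] are added at each stage. *)
Lemma torsion_finite_mod n : finite_mod p (torsion n).
Proof.
elim: n => [|n IH].
  exists [set 0]; first exact: finite_set1.
  move=> x [_]; rewrite expn0 mulr1n => ->; exists 0 => //.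
  by rewrite subrr; apply: subgroup0; exact: subgroup_multiples.
have [F fF [FT FU]] := @finite_index_sub U (torsion n.+1) oU.
apply: (@finite_mod_add _ _ _ F (torsion n.+1 `&` U)).
- exact: finite_mod_finite.
- apply: finite_mod_trans IH => u [[ru un] Uu].
  have [g _ gE] := noU Uu ru un.
  exists (u - r g *+ p).
    split; first by rewrite raddfB raddfMn rr ru.
    rewrite mulrnBl -mulrnA -expnS -(raddfMn r) gE raddfMn ru subrr //.
  by rewrite subKr; exists (r g).
- move=> x Tx; have [f Ff Uf] := FU x Tx; exists f => //; split => //.
  by apply: subgroupB => //; [exact: subgroup_torsion|exact: FT].
Qed.

(** Otherwise the part of [E_p] fixed by [r] and inside [U] is finite modulo [pG], like [torsion N].
    As [U] has finite index and [D_p] lies in [pG], the image of [r] would be too, against [nfr]. *)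
Lemma exists_nontorsion N : exists x, [/\ U x, r x = x, primary_part p x
  & ~ addset (multiples p) (torsion N) x].
Proof.
apply: contrapT => nx; apply: nfr.
have EUT x : U x -> r x = x -> primary_part p x ->
    addset (multiples p) (torsion N) x.
  by move=> Ux rx Ex; apply: contrapT => nxT; apply: nx; exists x.
pose H := primary_part p `&` [set x | r x = x].
have sH : subgroup H.
  by apply: subgroupI; [exact: subgroup_primary_part|exact: (subgroup_fix r)].
have [F fF [FH FU]] := @finite_index_sub U H oU.
apply: (@finite_mod_trans _ _ _ H) => [x rx|].
  have [d Dd Ed] := divisible_primary_partD pG x pp.
  exists (r (x - d)).
    by split; [apply: primary_part_hom => //; case: ir|exact: rr].
  rewrite raddfB rx subKr.
  by have := divisible_part_hom r Dd => /(_ 1%N I); rewrite expn1.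
apply: (@finite_mod_add _ _ _ F (H `&` U)); first exact: finite_mod_finite.
  apply: finite_mod_trans (torsion_finite_mod N) => x [[Ex rx] Ux].
  by have [g pg Tg] := EUT x Ux rx Ex; exists (x - g); rewrite ?subKr.
move=> x Hx; have [f Ff Uf] := FU x Hx; exists f => //; split => //.
by apply: subgroupB => //; exact: FH.
Qed.

(** * A chain of open subgroups with cyclic quotients *)

Section Chain.
Variables (N : nat) (x : G).
Hypothesis TN : torsion N.+1 `<=` torsion N.
Hypotheses (Ux : U x) (rx : r x = x) (Ex : primary_part p x).
Hypothesis nTx : ~ addset (multiples p) (torsion N) x.
Notation kerr := [set y | r y = 0].

(* [G / V] is cyclic of order [p ^ n], generated by [x]. *)
Definition cyclic_level n V := [/\ open_subgroup V, torsion N `<=` V, kerr `<=` V,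
  (forall y, cyclic_ext V x y) & forall k, V (x *+ k) <-> (p ^ n %| k)%N].

(** Keeps [x *+ p ^ n] out of [pV + torsion N + ker r]. Applying [r] removes [b]. For [n = 0] this
    contradicts [nTx]; otherwise [p ^ (n-1) x - r v] lies in [torsion N.+1], hence in [V], so
    [p ^ (n-1) x] is in [V], contradicting the order of [x] modulo [V]. *)
Lemma cyclic_level_divides n V v t b : cyclic_level n V -> V v -> torsion N t ->
  kerr b -> x *+ p ^ n = v *+ p + t + b -> False.
Proof.
move=> [[sV _] TV kV _ Vx] Vv Tt rb xE; have [rt _] := Tt.
have Vrv : V (r v).
  rewrite -(subKr v (r v)); apply: subgroupB => //; apply: kV.
  exact: (ker_sub ir).
have {}xE : x *+ p ^ n = r v *+ p + t.
  rewrite -{1}rx -raddfMn xE !raddfD (raddfMn r) rt.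
  by rewrite (_ : r b = 0) ?addr0.
case: n Vx xE => [|n] Vx xE.
  apply: nTx; exists (r v *+ p); first by exists (r v).
  by rewrite -{1}(mulr1n x) xE addrC addKr.
have : V (x *+ p ^ n).
  rewrite -(subrK (r v) (x *+ p ^ n)); apply: subgroupD => //.
  apply/TV/TN; split; first by rewrite raddfB (raddfMn r) rx rr.
  rewrite expnS mulrnA mulrnBl -mulrnA -expnSr xE addrC addKr.
  by have [] := Tt.
move/Vx; rewrite dvdn_Pexp2l ?prime_gt1 // ltnn //.
Qed.

(** [V'] is maximal in [V] over [pV + torsion N + ker r] plus a small open subgroup, without
    [x *+ p ^ n]. Then [V / V'] has order [p], generated by that element. *)
Lemma cyclic_levelS n V : cyclic_level n V ->
  exists2 V', cyclic_level n.+1 V' & V' `<=` V.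
Proof.
move=> lV; have [oV TV kV VT Vx] := lV; have [sV _] := oV.
pose K := addset (addset ((fun v => v *+ p) @` V) (torsion N)) kerr.
have sM : subgroup ((fun v => v *+ p) @` V).
  split; first by exists 0; [exact: subgroup0|exact: mul0rn].
  move=> _ _ [a Va <-] [b Vb <-]; exists (a - b); last exact: mulrnBl.
  exact: subgroupB.
have sT := subgroup_torsion N; have sk := subgroup_ker r.
have sMT := subgroup_addset sM sT.
have sK : subgroup K by exact: subgroup_addset.
have cK : closed K.
  apply: (closed_addset pG); last exact: (closed_ker pG ir).
  apply: (closed_addset pG); last exact: closed_torsion.
  apply: (closed_image pG pG); first exact: mulrn_continuous.
  exact: open_subgroup_closed.
have nKx : ~ K (x *+ p ^ n).
  move=> [a [_ [v Vv <-] Tt] kb].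
  apply: (cyclic_level_divides lV Vv Tt kb); rewrite [X in X + _]addrC subrK.
  by rewrite addrC subrK.
have KV : K `<=` V.
  move=> y [a [_ [v Vv <-] Tt] kb]; rewrite -(subrK a y).
  apply: subgroupD => //; first exact: kV.
  rewrite -(subrK (v *+ p) a); apply: subgroupD => //; first exact: TV.
  exact: subgroupMn.
have [W oW WK] := open_subgroup_sep pG cK nKx; have [sW _] := oW.
have oWV := open_subgroupI oW oV; have [sWV _] := oWV.
have sKW := subgroup_addset sK sWV.
have KWV : addset K (W `&` V) `<=` V.
  move=> y [a Ka [_ Va]]; rewrite -(subrK a y).
  by apply: subgroupD => //; exact: KV.
have Vxn : V (x *+ p ^ n) by apply/Vx.
(* Exponent [0] suffices: [pV] lies in [K], so [V / K] is already killed by [p]. *)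
have [||V' [sV' KV' V'V nV'x VV']] := max_subgroup (n := 0) pp sV sKW KWV Vxn.
- move=> y Vy; apply: addsetl => //; apply: addsetl => //; apply: addsetl => //.
  by rewrite expn1; exists y.
- by rewrite expn0 mulr1n => -[a Ka [Wa _]]; exact: (WK a).
have KVx : K `<=` V' by move=> y Ky; apply/KV'/addsetl.
have oV' : open_subgroup V'.
  apply: (subgroup_open_sub oWV) => // y Wy; apply: KV'.
  exact: addsetr.
rewrite expn0 mulr1n in nV'x.
have V'xp : V' (x *+ p ^ n *+ p).
  by apply: KVx; do 2 apply: addsetl => //; exists (x *+ p ^ n).
exists V' => //; split => //.
- by move=> t Tt; apply: KVx; apply: addsetl => //; exact: addsetr.
- by move=> b kb; apply: KVx; exact: addsetr.
- move=> y; have [k /VV'[j Vj]] := VT y; exists (k + p ^ n * j)%N.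
  by rewrite mulrnDr opprD addrA mulrnA.
move=> k; split => [V'k|/dvdnP[j ->]]; last first.
  by rewrite mulnC mulrnA expnSr mulrnA; exact: subgroupMn.
have /dvdnP[j jE] := iffLR (Vx k) (V'V _ V'k).
rewrite jE expnS dvdn_pmul2r ?expn_gt0 ?prime_gt0 //.
apply: contrapT => /negP; rewrite -prime_coprime // => co; apply: nV'x.
apply: (subgroup_coprime sV' co) => //.
by rewrite -mulrnA mulnC -jE.
Qed.

Lemma splits_off_torsionfree :
  exists2 e, splits_off r e U & finite_mod p [set e y | y in [set: G]].
Proof.
have /choice[f fP] (z : nat * set G) : exists V',
    cyclic_level z.1 z.2 -> cyclic_level z.1.+1 V' /\ V' `<=` z.2.
  have [/cyclic_levelS[V' ? ?]|nz] := pselect (cyclic_level z.1 z.2).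
    by exists V'.
  by exists setT.
pose V := fix V n := if n is n'.+1 then f (n', V n') else [set: G].
have lV n : cyclic_level n (V n).
  elim: n => [|n IH]; last by have [] := fP (n, V n) IH.
  split => //; first by split; [exact: subgroupT|exact: openT].
  by move=> y; exists 0%N.
have VS n : V n.+1 `<=` V n by have [] := fP (n, V n) (lV n).
have Vle m n : (m <= n)%N -> V n `<=` V m.
  move=> /subnK <-; elim: (n - m)%N => //= i IH.
  exact: subset_trans (VS _) IH.
have oV n : open_subgroup (V n) by case: (lV n).
have cV n : closed (V n) by exact: open_subgroup_closed.
have [||||||||||e se Ce] := @splits_off_subgroups G pG r ir U (procyclic x)
    (\bigcap_n V n).
- exact: subgroup_procyclic.
- by apply: subgroup_bigcap => n _; case: (oV n).
- exact: closed_procyclic.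
- by apply: closed_bigI => n _.
(* Modulo [p ^ n G], [y] is some [j x] lying in [V n], so [p ^ n] divides [j]. Thus [y] is in [D_p],
   and it is in [E_p] because [x] is. *)
- move=> y Cy Vy; apply: (divisible_primary_part0 pG pp); last first.
    apply: procyclic_min Cy; first exact: closed_primary_part.
    move=> n; apply: subgroupMn Ex; exact: subgroup_primary_part.
  move=> n _; apply: contrapT => nny.
  have [W oW WM] := open_subgroup_sep pG (@closed_multiples _ pG _) nny.
  have [j [Wj Vj]] := Cy _ (open_subgroupI oW (oV n)).
  have [[sVn _] _ _ _ Vx] := lV n.
  have /Vx/dvdnP[i iE] : V n (x *+ j).
    by rewrite -(subKr y (x *+ j)); apply: subgroupB => //; exact: Vy.
  apply: WM Wj; rewrite iE; exists (x *+ i) => //.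
  by rewrite -mulrnA.
(* The procyclic component of [y] is a cluster point of the multiples of [x] congruent to [y] modulo
   [V n]. *)
- move=> y.
  have /choice[k kP] n : exists k, V n (y - x *+ k).
    by have [_ _ _ VT _] := lV n; exact: VT.
  have [cG _ _] := pG; have [l cl] := cluster_seq cG (fun n => x *+ k n).
  exists l.
    apply: cl; first exact: closed_procyclic.
    by exists 0%N => n _; exact: procyclic_mem.
  move=> m _; apply: (cl [set c | V m (y - c)]).
    exact: (closed_preimage (@rsubr_continuous _ y)).
  by exists m => n mn; exact: (Vle _ _ mn).
- apply: procyclic_min; first exact: open_subgroup_closed.
  by move=> n; exact: subgroupMn.
- apply: procyclic_min; first exact: (closed_fix pG ir).
  by move=> n /=; rewrite raddfMn rx.
- by move=> y ry n _; have [_ _ + _ _] := lV n; apply.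
- exists x; first by rewrite -(mulr1n x); exact: procyclic_mem.
  apply/eqP => x0; apply: nTx; rewrite x0; apply: subgroup0.
  by apply: subgroup_addset; [exact: subgroup_multiples|exact: subgroup_torsion].
exists e => //; have [F fF FC] := procyclic_finite_mod x (prime_gt0 pp).
by exists F => // _ [y _ <-]; exact/FC/Ce.
Qed.

End Chain.

End ProcyclicFactor.

Lemma splits_off_infinite_rank (G : topologicalZmodType) (r : {additive G -> G})
  p (U : set G) : profinite G -> idempotent_endo r -> prime p ->
  open_subgroup U -> ~ finite_mod p [set x | r x = x] ->
  exists2 e, splits_off r e U & finite_mod p [set e x | x in [set: G]].
Proof.
move=> pG ir pp oU nf; have [sU _] := oU.
have [[n [x [Ux rx xp nx]]]|no] := pselect (exists n x,
  [/\ U x, r x = x, x *+ p ^ n.+1 = 0 & ~ multiples (p ^ n.+1) (x *+ p ^ n)]).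
  exact: splits_off_finite_cyclic nx.
have noU n x : U x -> r x = x -> x *+ p ^ n.+1 = 0 ->
    multiples (p ^ n.+1) (x *+ p ^ n).
  by move=> Ux rx xp; apply: contrapT => nx; apply: no; exists n, x.
have [N TN] := torsion_bounded pG ir pp oU noU.
have [x [Ux rx Ex nTx]] := exists_nontorsion pG ir pp oU nf noU N.
exact: splits_off_torsionfree TN Ux rx Ex nTx.
Qed.

(** * Infinite families of orthogonal idempotents *)

Section Splittable.
Variable G : topologicalZmodType.
Hypothesis pG : profinite G.
Implicit Types (x y : G) (r e : {additive G -> G}) (U V : set G).

(** [P] is a largeness condition on the remaining factor that survives a suitable splitting, so
    splittings can be iterated. *)
Definition splittable (P : {additive G -> G} -> Prop) :=
  forall r U, idempotent_endo r -> open_subgroup U -> P r ->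
    exists2 e, splits_off r e U & P (r \- e).

Definition infinitely_many_primes r :=
  forall M, exists2 p, prime p /\ (M < p)%N &
  exists2 x, primary_part p x & r x = x /\ x != 0.

(** If [p] exceeds the exponent [M] of [G / U], then [E_p] lies in [U]. Splitting it off leaves
    [E_q] untouched for every prime [q > p]. *)
Lemma splittable_primes : splittable infinitely_many_primes.
Proof.
move=> r U ir oU inf; have [M M0 UM] := open_subgroup_exponent pG oU.
have [p [pp Mp] ex] := inf M; have [sU _] := oU.
have EU : primary_part p `<=` U.
  move=> x Ex; have [n Un] := Ex U oU; apply: (subgroup_coprime sU _ Un (UM x)).
  by apply: coprimeXl; rewrite prime_coprime // gtnNdvd.
have [e se Ee] := splits_off_primary pG ir pp EU ex; exists e => //.
move=> M'; have [q [pq M'q] [x Ex [rx x0]]] := inf (maxn M' p).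
move: M'q; rewrite gtn_max => /andP[M'q pltq].
exists q => //; exists x => //; split => //=.
have [[ce _] _ _ _ _] := se.
have -> : e x = 0.
  apply: (primary_parts0 pG pp pq); [by rewrite ltn_eqF|exact: Ee|].
  exact: primary_part_hom.
by rewrite subr0.
Qed.

Lemma splittable_infinite_rank p : prime p ->
  splittable (fun r => ~ finite_mod p [set x | r x = x]).
Proof.
move=> pp r U ir oU nf.
have [e se fe] := splits_off_infinite_rank pG ir pp oU nf.
exists e => // f'; apply: nf; apply: (finite_mod_add fe f') => x rx /=.
have [[_ ee] re er _ _] := se.
by exists (e x); [exists x|rewrite /= !raddfB rx re ee subrr addr0].
Qed.

Section Sequence.
Variable W : nat -> set G.
Hypotheses (oW : forall n, open_subgroup (W n)) (WS : forall n, W n.+1 `<=` W n).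
Hypothesis W0 : forall x, (forall n, W n x) -> x = 0.
Variable P : {additive G -> G} -> Prop.
Hypotheses (spP : splittable P) (Pid : P idfun).

Lemma splitting_sequence : exists r e : nat -> {additive G -> G},
  [/\ r 0%N = idfun, forall n, r n.+1 = r n \- e n,
      forall n, idempotent_endo (r n) & forall n, splits_off (r n) (e n) (W n)].
Proof.
(* [idfun] is a dummy value for arguments that violate the invariant. *)
have /choice[f fP] (z : nat * {additive G -> G}) : exists e : {additive G -> G},
    idempotent_endo z.2 /\ P z.2 -> splits_off z.2 e (W z.1) /\ P (z.2 \- e).
  have [[iz Pz]|nz] := pselect (idempotent_endo z.2 /\ P z.2).
    by have [e se Pe] := spP iz (oW z.1) Pz; exists e.
  by exists idfun.
pose r := fix r n : {additive G -> G} :=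
  if n is n'.+1 then r n' \- f (n', r n') else idfun.
have rP n : idempotent_endo (r n) /\ P (r n).
  elim: n => [|n [ir Pr]].
    by split => //; split => // x; exact: cvg_id.
  have [[[ce ee] re er _ _] Pe] := fP (n, r n) (conj ir Pr).
  have [cr rr] := ir.
  split => //; split; first exact: continuous_subr.
  by move=> x /=; rewrite !raddfB rr re er ee subrr addr0.
exists r, (fun n => f (n, r n)); split => // n; first by have [] := rP n.
by have [] := fP (n, r n) (rP n).
Qed.

Lemma orthogonal_idempotents : exists e : nat -> {additive G -> G},
  [/\ forall n, idempotent_endo (e n), forall m n x, m != n -> e m (e n x) = 0,
      forall x, (forall n, e n x = 0) -> x = 0 & forall n, exists x, e n x != 0].
Proof.
have [r [e [r0 rS ir se]]] := splitting_sequence.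
have rE n x : r n.+1 x = r n x - e n x by rewrite rS.
have rr n x : r n (r n x) = r n x by case: (ir n).
have cr n : continuous (r n) by case: (ir n).
have ie n : idempotent_endo (e n) by case: (se n).
have ee n x : e n (e n x) = e n x by case: (ie n).
have re n x : r n (e n x) = e n x by case: (se n).
have er n x : e n (r n x) = e n x by case: (se n).
have eW n x : W n (e n x) by case: (se n).
have rS_e n x : r n.+1 (e n x) = 0 by rewrite rE re ee subrr.
have e_rS n x : e n (r n.+1 x) = 0 by rewrite rE raddfB er ee subrr.
have rle m n x : (m <= n)%N -> r m (r n x) = r n x /\ r n (r m x) = r n x.
  move=> /subnK <-; elim: (n - m)%N x => [|i IH] x; first by rewrite rr.
  rewrite addSn !rE raddfB; have [IH1 IH2] := IH x; split; last first.
    by rewrite IH2 -(er _ (r m x)) IH2 er.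
  by have [+ _] := IH (e (i + m)%N x); rewrite re IH1 => ->.
have Wle m n : (m <= n)%N -> W n `<=` W m.
  move=> /subnK <-; elim: (n - m)%N => //= i IH.
  exact: subset_trans (@WS _) IH.
have e_lt m n x : (m < n)%N -> e m (e n x) = 0.
  by move=> mn; rewrite -(re n x) -(rle _ _ _ mn).1 e_rS.
have e_gt m n x : (n < m)%N -> e m (e n x) = 0.
  by move=> nm; rewrite -er -(rle _ _ _ nm).2 rS_e !raddf0.
have r_e_le m n x : (m <= n)%N -> r m (e n x) = e n x.
  by move=> mn; rewrite -(re n x) (rle _ _ _ mn).1.
have r_e_gt m n x : (n < m)%N -> r m (e n x) = 0.
  by move=> nm; rewrite -(rle _ _ _ nm).2 rS_e raddf0.
(* [H] is what remains after all splittings. Its complement [L] contains the image of each [e n]: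
   [r m] kills it for [m > n] and otherwise fixes it inside [W m]. *)
pose H := \bigcap_n [set x | r n x = x].
pose L := \bigcap_n (r n @^-1` W n).
have sH : subgroup H by apply: subgroup_bigcap => n _; exact: (subgroup_fix (r n)).
have sL : subgroup L.
  by apply: subgroup_bigcap => n _; apply: subgroup_preimage; case: (oW n).
have cH : closed H by apply: closed_bigI => n _; exact: (closed_fix pG (ir n)).
have cL : closed L.
  apply: closed_bigI => n _; apply: closed_preimage => //.
  exact: open_subgroup_closed.
have HL0 x : H x -> L x -> x = 0.
  by move=> Hx Lx; apply: W0 => n; rewrite -(Hx n I); exact: Lx.
(* The [H]-component is a cluster point of [r n x]: [x - r n x] is the sum of the [e i x] with
   [i < n], of which [r m] keeps those with [i >= m], all in [W m]. *)
have HLT x : addset H L x.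
  have [cG _ _] := pG; have [l cl] := cluster_seq cG (fun n => r n x).
  exists l => m _.
    apply: (cl [set y | r m y = y]); first exact: (closed_fix pG (ir m)).
    by exists m => n mn; exact: (rle _ _ _ mn).1.
  have [sWm _] := oW m.
  apply: (cl [set y | W m (r m (x - y))]).
    apply: (closed_preimage (f := fun y => r m (x - y))) => [y|].
      apply: (@continuous_comp _ _ _ (fun y => x - y) (r m)); last exact: cr.
      exact: rsubr_continuous.
    exact: open_subgroup_closed.
  exists m => n /subnK <- /=; elim: (n - m)%N => [|i IH].
    by rewrite raddfB rr subrr; exact: subgroup0.
  rewrite addSn rE opprB addrA [x + _]addrC -addrA raddfD r_e_le ?leq_addl //.
  by apply: subgroupD => //; apply: Wle (eW _ _); exact: leq_addl.
have [s [[cs sH' sL'] [s1 s0]]] := projection_along pG sH sL cH cL HL0 HLT.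
have se0 n x : s (e n x) = 0.
  apply: s0 => m _ /=; have [mn|nm] := leqP m n.
    by rewrite r_e_le //; exact: Wle (eW _ _).
  by rewrite r_e_gt //; apply: subgroup0; case: (oW m).
have es0 n x : e n (s x) = 0 by rewrite -(sH' x n.+1 I) e_rS.
have ss x : s (s x) = s x by exact: s1.
(* [s] is added to [e 0] instead of forming a factor of its own, which would be trivial when [H] is
   zero. *)
pose e' n : {additive G -> G} := if n is 0%N then e 0%N \+ s else e n.
exists e'; split.
- move=> [|n]; last exact: ie.
  split; first by apply: continuous_addr => //; case: (ie 0%N).
  by move=> x /=; rewrite !raddfD ee ss se0 es0 addr0 add0r.
- move=> [|m] [|n] x //= mn; first by rewrite e_lt // se0 addr0.
    by rewrite raddfD es0 e_gt // addr0.
  by move: mn; rewrite neq_ltn => /orP[/e_lt|/e_gt]; apply.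
- move=> x ex0; have sx : s x = 0.
    by have := congr1 s (ex0 0%N); rewrite /= raddfD se0 ss add0r raddf0.
  have {}ex0 n : e n x = 0.
    by case: n => [|n]; [have := ex0 0%N; rewrite /= sx addr0|exact: ex0 n.+1].
  have rx n : r n x = x.
    by elim: n => [|n IH]; [rewrite r0|rewrite rE IH ex0 subr0].
  by apply: W0 => n; rewrite -(rx n) -(subr0 x) -sx; exact: sL'.
- move=> [|n]; last by case: (se n.+1).
  have [_ _ _ _ [x x0]] := se 0%N.
  by exists (e 0%N x); rewrite /= ee se0 addr0.
Qed.

End Sequence.

End Splittable.

(** * Decomposition as a product *)

Section FixedPoints.
Variables (G : topologicalZmodType) (r : {additive G -> G}).

Definition fixed_points : Type := {x : G | r x == x}.

HB.instance Definition _ := SubChoice.on fixed_points.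

Let fixed0 : r 0 == 0. Proof. by rewrite raddf0. Qed.
Let fixedN (x : fixed_points) : r (- val x) == - val x.
Proof. by rewrite raddfN (eqP (valP x)). Qed.
Let fixedD (x y : fixed_points) : r (val x + val y) == val x + val y.
Proof. by rewrite raddfD (eqP (valP x)) (eqP (valP y)). Qed.

Let fzero : fixed_points := exist _ 0 fixed0.
Let fopp (x : fixed_points) : fixed_points := exist _ (- val x) (fixedN x).
Let fadd (x y : fixed_points) : fixed_points := exist _ (val x + val y) (fixedD x y).

Let faddA : associative fadd.
Proof. by move=> x y z; apply: val_inj; exact: addrA. Qed.
Let faddC : commutative fadd.
Proof. by move=> x y; apply: val_inj; exact: addrC. Qed.
Let fadd0 : left_id fzero fadd.
Proof. by move=> x; apply: val_inj; exact: add0r. Qed.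
Let faddN : left_inverse fzero fopp fadd.
Proof. by move=> x; apply: val_inj; exact: addNr. Qed.

HB.instance Definition _ :=
  GRing.isZmodule.Build fixed_points faddA faddC fadd0 faddN.

HB.instance Definition _ :=
  Topological.copy fixed_points (initial_topology (val : fixed_points -> G)).

Lemma fixed_points_val_continuous : continuous (val : fixed_points -> G).
Proof. exact: initial_continuous. Qed.

Let fsub_continuous : continuous (fun x : fixed_points * fixed_points => x.1 - x.2).
Proof.
apply: continuous_comp_initial => x.
apply: (@continuous_comp _ _ _
  (fun y : fixed_points * fixed_points => (val y.1, val y.2))
  (fun u : G * G => u.1 - u.2)); last exact: sub_continuous.
apply: cvg_pair => /=; apply: continuous_comp.
- exact: cvg_fst.
- exact: fixed_points_val_continuous.
- exact: cvg_snd.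
- exact: fixed_points_val_continuous.
Qed.

HB.instance Definition _ :=
  PreTopologicalNmodule_isTopologicalZmodule.Build fixed_points fsub_continuous.

End FixedPoints.

Section FixedPointsOfIdempotent.
Variables (G : topologicalZmodType) (r : {additive G -> G}).
Hypotheses (pG : profinite G) (ir : idempotent_endo r).

Let rrE x : r (r x) == r x. Proof. by case: ir => _ rr; exact/eqP. Qed.

Definition to_fixed_points (x : G) : fixed_points r := exist _ (r x) (rrE x).

Lemma to_fixed_pointsB : {morph to_fixed_points : x y / x - y}.
Proof. by move=> x y; apply: val_inj => /=; exact: raddfB. Qed.

Lemma to_fixed_points_continuous : continuous to_fixed_points.
Proof. by apply: continuous_comp_initial; case: ir. Qed.

Lemma val_fixed_pointsK (x : fixed_points r) : to_fixed_points (val x) = x.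
Proof. by apply: val_inj => /=; exact/eqP/(valP x). Qed.

Lemma profinite_fixed_points : profinite (fixed_points r).
Proof.
have cv := @fixed_points_val_continuous _ r.
case: (pG) => cG hG _; split.
- rewrite (_ : setT = to_fixed_points @` setT).
    apply: continuous_compact => //.
    exact/continuous_subspaceT/to_fixed_points_continuous.
  apply/seteqP; split => // x _; exists (val x) => //.
  exact: val_fixed_pointsK.
- move=> x y xy; apply/val_inj/hG => A B Ax By.
  have [z [Az Bz]] := xy _ _ (cv x A Ax) (cv y B By).
  by exists (val z).
(* Cosets of open subgroups of [G] restrict to clopen sets separating points. *)
- apply: zero_dimension_totally_disconnected => x y xy.
  have nxy : val x - val y <> 0.
    by move/eqP; rewrite subr_eq0 => /eqP/val_inj/eqP; exact/negP.
  have [V oV nV] : exists2 V, open_subgroup V & ~ V (val x - val y).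
    apply: contrapT => nV; apply: nxy; apply: (profinite_eq0 pG) => V oV.
    by apply: contrapT => nVxy; apply: nV; exists V.
  exists (val @^-1` [set z | V (val x - z)]); split => //.
    apply: preimage_clopen => //; split.
      by apply: (open_preimage (@rsubr_continuous _ _)); case: oV.
    apply: (closed_preimage (@rsubr_continuous _ _)).
    exact: open_subgroup_closed.
  by rewrite /= subrr; apply: subgroup0; case: oV.
Qed.

End FixedPointsOfIdempotent.

Section ProductDecomposition.
Variables (G : topologicalZmodType) (e : nat -> {additive G -> G}).
Hypotheses (pG : profinite G) (ie : forall n, idempotent_endo (e n)).
Hypothesis orth : forall m n x, m != n -> e m (e n x) = 0.
Hypothesis joint_inj : forall x, (forall n, e n x = 0) -> x = 0.

Let K n : topologicalZmodType := fixed_points (e n).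

Let f (x : G) : prod_topology K := fun n => to_fixed_points (ie n) x.

Let fB : {morph f : x y / x - y}.
Proof.
by move=> x y; apply: functional_extensionality_dep => n; exact: to_fixed_pointsB.
Qed.

Let f_continuous : continuous f.
Proof.
move=> x; apply/cvg_sup => n.
suff: continuous (f : G -> initial_topology (fun g : prod_topology K => g n)).
  by apply.
apply: continuous_comp_initial; exact: to_fixed_points_continuous.
Qed.

Let f_inj : injective f.
Proof.
move=> x y fxy; apply/eqP; rewrite -subr_eq0; apply/eqP/joint_inj => n.
rewrite raddfB; apply/eqP; rewrite subr_eq0; apply/eqP.
exact: (congr1 (fun g : prod_topology K => val (g n)) fxy).
Qed.

(** Take a cluster point of the partial sums of [k]: by orthogonality [e n] is constant on the sums
    past index [n], and its fibres are closed. *)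
Let f_surj (k : prod_topology K) : exists x, f x = k.
Proof.
have [cG _ _] := pG.
have [l cl] := cluster_seq cG (fun n => \sum_(i < n) val (k i)).
exists l; apply: functional_extensionality_dep => n; apply: val_inj => /=.
apply: (cl [set y | e n y = val (k n)]).
  apply: (closed_preimage (A := [set val (k n)])); first by case: (ie n).
  by apply: (closed_finite pG); exact: finite_set1.
have ek i : e i (val (k i)) = val (k i) by exact/eqP/(valP (k i)).
exists n.+1 => m nm /=; rewrite raddf_sum (bigD1 (Ordinal nm)) //= ek.
rewrite big1 ?addr0 // => i ni; rewrite -ek orth //.
by rewrite eq_sym; move: ni; apply: contra => /eqP ni; apply/eqP/val_inj.
Qed.

(** The inverse is continuous because [f], from a compact to a Hausdorff space, is a closed map. *)
Lemma isomorphic_product : topologically_isomorphic G (prod_topology K).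
Proof.
have /choice[g fg] := f_surj.
have gf : cancel f g by move=> x; apply: f_inj; rewrite fg.
pose f' : {additive G -> prod_topology K} :=
  HB.pack f (GRing.isZmodMorphism.Build G (prod_topology K) f fB).
exists f', g; split => //.
apply/continuous_closedP => Z cZ; rewrite (_ : g @^-1` Z = f @` Z); last first.
  by apply/seteqP; split => [k Zk|_ [x Zx <-]]; [exists (g k)|rewrite /= gf].
apply: compact_closed.
  apply: hausdorff_product => n.
  by have [] := profinite_fixed_points pG (ie n).
apply: continuous_compact; first exact: continuous_subspaceT.
exact: closed_compact.
Qed.

End ProductDecomposition.

(** Put an open subgroup inside each member of the enumerated base, [setT] at indices not attained,
    and take running intersections. *)
Lemma open_subgroup_basis (G : topologicalZmodType) : profinite G ->
  countably_based G -> exists W : nat -> set G,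
  [/\ forall n, open_subgroup (W n), forall n, W n.+1 `<=` W n
    & forall x, (forall n, W n x) -> x = 0].
Proof.
move=> pG [B [/countable_injP[f f_inj] B0 BU]].
have /choice[V VP] n : exists V, open_subgroup V /\
    forall b, B b -> f b = n -> V `<=` b.
  have [[b [Bb fb]]|nb] := pselect (exists b, B b /\ f b = n).
    have [V oV Vb] := open_subgroup_nbhs pG (B0 _ Bb); exists V; split => // b'.
    move=> Bb' fb'; have -> // : b' = b.
    by apply: f_inj; rewrite ?inE // fb fb'.
  exists setT; split; first by split; [exact: subgroupT|exact: openT].
  by move=> b Bb fb; exfalso; apply: nb; exists b.
pose W := fix W n := if n is n'.+1 then W n' `&` V n'.+1 else V 0%N.
have WV n : W n `<=` V n by case: n => [|n] //= x [].
exists W; split.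
- elim=> [|n IH]; first by case: (VP 0%N).
  by apply: open_subgroupI => //; case: (VP n.+1).
- by move=> n x [].
- move=> x Wx; apply: (profinite_eq0 pG) => U [sU oU].
  have [|b Bb bU] := BU U.
    by apply: open_nbhs_nbhs; split => //; exact: subgroup0.
  by apply: bU; have [_ /(_ b Bb erefl)] := VP (f b); apply; exact/WV/Wx.
Qed.

Lemma multiplicative_nat (Q : nat -> Prop) : Q 1%N ->
  (forall m n, Q m -> Q n -> Q (m * n)%N) -> (forall p, prime p -> Q p) ->
  forall n, (0 < n)%N -> Q n.
Proof.
move=> Q1 QM Qp; elim/ltn_ind => n IH n0.
have [->//|n1] := eqVneq n 1%N.
have pn : prime (pdiv n) by rewrite pdiv_prime // ltn_neqAle eq_sym n1.
rewrite -(divnK (pdiv_dvd n)); apply: QM; last exact: Qp.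
apply: IH; first by rewrite ltn_Pdiv // prime_gt1.
by rewrite divn_gt0 ?prime_gt0 // dvdn_leq // pdiv_dvd.
Qed.

(** * Topological finite generation *)

Section FinitelyGenerated.
Variable G : topologicalZmodType.
Hypothesis pG : profinite G.

Lemma finite_mod_mul m n : finite_mod m [set: G] -> finite_mod n [set: G] ->
  finite_mod (m * n) [set: G].
Proof.
move=> [F fF FT] [F' fF' FT'].
exists [set x + y *+ m | x in F & y in F']; first exact: finite_image2.
move=> x _; have [f Ff [y _ yx]] := FT x I; have [f' Ff' [z _ zy]] := FT' y I.
exists (f + f' *+ m); first by exists f => //; exists f'.
exists z => //; rewrite mulnC mulrnA zy mulrnBl yx opprD addrA //.
Qed.

(** Representatives of [G] modulo the factorial of [M] generate a dense [S]. For prime [n],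
    [S + V + nG] is [G]: either [n <= M] divides that factorial, or [E_n = 0] and [G = D_n = nG].
    This extends to products, and the exponent [n] of [G / V] gives [S + V = G]. *)
Lemma topologically_finitely_generatedP M :
  (forall p, prime p -> finite_mod p [set: G]) ->
  (forall p, prime p -> (M < p)%N -> forall x : G, primary_part p x -> x = 0) ->
  topologically_finitely_generated G.
Proof.
move=> fp E0.
have fin n : (0 < n)%N -> finite_mod n [set: G].
  apply: (@multiplicative_nat (fun n => finite_mod n [set: G])) => //;
    last exact: finite_mod_mul.
  exists [set 0]; first exact: finite_set1.
  by move=> x _; exists 0 => //; exists x => //; rewrite subr0.
have [F fF FM] := fin M`! (fact_gt0 M).
exists F => // O [g Og] oO.
have : nbhs (0 : G) [set y | O (g - y)].
  apply: (@rsubr_continuous _ g 0 O); rewrite subr0.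
  by apply: open_nbhs_nbhs.
move/(open_subgroup_nbhs pG) => [V oV VO]; have [sV _] := oV.
set S := generated_subgroup F.
have FS : F `<=` S by exact: sub_smallest.
have sS : subgroup S.
  split=> [H [[H0 _] _]|x y Sx Sy H HF]; first exact: (set_mem H0).
  have [[_ HB] _] := HF; apply: set_mem.
  exact: (HB x y (mem_set (Sx H HF)) (mem_set (Sy H HF))).
have sSV := subgroup_addset sS sV.
have SVn n : (0 < n)%N -> forall x, addset (addset S V) (multiples n) x.
  apply: (@multiplicative_nat
    (fun n => forall x, addset (addset S V) (multiples n) x)) =>
    [x|a b Qa Qb x|p pp x].
  - by exists 0; [exact: subgroup0|exists x; rewrite ?subr0].
  - have [y Sy [z _ zx]] := Qa x; have [y' Sy' [z' _ z'z]] := Qb z.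
    exists (y + y' *+ a); first by apply: subgroupD => //; exact: subgroupMn.
    by exists z' => //; rewrite mulnC mulrnA z'z mulrnBl zx opprD addrA.
  - have [pM|Mp] := leqP p M.
      have [y Fy [z _ zx]] := FM x I; exists y.
        by apply: addsetl => //; exact: FS.
      have /dvdnP[k kE] : (p %| M`!)%N by rewrite dvdn_fact // prime_gt0.
      by exists (z *+ k) => //; rewrite -mulrnA -kE.
    exists 0; first exact: subgroup0.
    have [d Dd Ed] := divisible_primary_partD pG x pp.
    have /eqP := E0 p pp Mp _ Ed; rewrite subr0 subr_eq0 => /eqP ->.
    by have := Dd 1%N I; rewrite expn1.
have [n n0 Vn] := open_subgroup_exponent pG oV.
have [y SVy [z _ zg]] := SVn n n0 g.
have [s Ss Vs] : addset S V g.
  rewrite -(subrK y g) -zg; apply: subgroupD => //.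
  exact: addsetr.
exists s; split => //.
by have := VO _ Vs; rewrite /= subKr.
Qed.

End FinitelyGenerated.

Theorem corollary2p6 (G : topologicalZmodType) :
  profinite G -> countably_based G -> ~ topologically_finitely_generated G ->
  exists (I : Type) (K : I -> topologicalZmodType),
    [/\ infinite_set [set: I],
        forall i, profinite (K i) /\ (exists x : K i, x != 0)
      & topologically_isomorphic G (prod_topology K)].
Proof.
move=> pG cbG nfg.
(* The invariant is infinite rank at some prime [p] or, when every [G / pG] is finite, the presence
   of infinitely many primes. *)
have [P spP Pid] : exists2 P, @splittable G P & P idfun.
  have [[p [pp np]]|nfin] :=
      pselect (exists p, prime p /\ ~ finite_mod p [set: G]).
    exists (fun r => ~ finite_mod p [set x | r x = x]).
      exact: splittable_infinite_rank.
    by rewrite (_ : [set x | _] = setT) //; apply/seteqP.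
  exists (@infinitely_many_primes G); first exact: splittable_primes.
  move=> M; apply: contrapT => nM; apply: nfg.
  apply: (topologically_finitely_generatedP pG (M := M)) => [p pp|p pp Mp x Ex].
    by apply: contrapT => nf; apply: nfin; exists p.
  apply: contrapT => /eqP x0; apply: nM; exists p => //.
  by exists x.
have [W [oW WS W0]] := open_subgroup_basis pG cbG.
have [e [ie orth inj ne0]] := orthogonal_idempotents pG oW WS W0 spP Pid.
exists nat, (fun n => fixed_points (e n)); split.
- exact: infinite_nat.
- move=> n; split; first exact: profinite_fixed_points.
  have [x x0] := ne0 n; exists (to_fixed_points (ie n) x).
  by apply: contra x0 => /eqP/(congr1 val) /= ->.
- exact: isomorphic_product ie orth inj.
Qed.
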